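(* Let $X=\overline{\mathcal{R}[T_\infty]}$ be the Ghys–Kenyon minimal set, and for $\alpha\in\mathcal{S}_4=\{0,1,2,3\}^{\mathbb{N}}$ let $\Phi(\alpha)$ be the coded tree. Then for every $\alpha\in\mathcal{S}_4$, $X=\overline{\mathcal{R}[\Phi(\alpha)]}$. Moreover, $X$ is the disjoint union of the class $\mathcal{R}[T_\infty]$ and of the saturated set $\bigcup_{\alpha\in\mathcal{S}_4}\mathcal{R}[\Phi(\alpha)]$.
   Context: Ambient space. $\mathcal{Z}^2$ is the Cayley graph of $\mathbb{Z}^2$ for the generators $(\pm1,0),(0,\pm1)$ (vertices $\mathbb{Z}^2\subset\mathbb{C}$, edges of length 1 between points at distance 1). $\mathcal{T}$ is the set of infinite connected subgraphs of $\mathcal{Z}^2$ containing $0$. For $T\in\mathcal{T}$, $B_T(0,N)$ is the open ball of centre $0$ and radius $N$ for the path metric of $T$. For $T,T'\in\mathcal{T}$ let $R(T,T')=\sup\{N\geq1: B_T(0,N)=B_{T'}(0,N)\}$ ($0$ if this set is empty) and $d(T,T')=e^{-R(T,T')}$; $(\mathcal{T},d)$ is compact. $\mathcal{R}$ identifies $T$ and $T'$ iff $T'=T-v$ for some vertex $v$ of $T$; $\mathcal{R}[T]$ is the class of $T$, and its closure in $\mathcal{T}$ is the envelope of $T$. Kenyon tree. $T_1$ is the tree made of the segments $[-1,1]\times\{0\}$ and $\{0\}\times[-2,2]$. Given $T_n$, take the union of the images of $T_n+(0,2^n)$ under the rotations about $0$ of angles $0,\pi/2,\pi,3\pi/2$,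 and remove the two terminal edges (with their terminal vertices) contained in the horizontal axis; the result is $T_{n+1}$. The $T_n$ are increasing, $T_n$ meets the axes in $[-2^n+1,2^n-1]\times\{0\}$ and $\{0\}\times[-2^n,2^n]$, and $T_\infty=\bigcup_{n\geq1}T_n$. Coding. Put $\mathbf{r}(k)=e^{\frac{\pi}{2}ik}$ for $k\in\{0,1,2,3\}=\mathbb{Z}_4$. For $\alpha=\alpha_0\alpha_1\dots\in\mathcal{S}_4$ let $x_0=0$ and $x_{n}=x_{n-1}+2^{n-1}\mathbf{r}(\alpha_{n-1})$. Let $P_0=\{0\}$; given the finite tree $P_n$, there is a unique edge of $\mathcal{Z}^2$ joining $x_{n+1}$ to a vertex of $P_n$; $P_{n+1}$ is the union of $P_n$ together with this edge and of their images under the rotations of centre $x_{n+1}$ and angles $\pi/2,\pi,3\pi/2$. Then $\Phi(\alpha)=\bigcup_{n\geq0}P_n\in\mathcal{T}$. *)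

(* Defs.v *)
From HB Require Import structures.
From mathcomp Require Import all_boot all_order all_algebra.
From mathcomp Require Import zify.
From mathcomp Require Import boolp classical_sets functions cardinality reals.
From mathcomp Require Import constructive_ereal ereal topology sequences exp.

Set Implicit Arguments.
Unset Strict Implicit.
Unset Printing Implicit Defensive.

Import Order.TTheory GRing.Theory Num.Theory.
Local Open Scope classical_set_scope.
Local Open Scope ring_scope.

(** * Subgraphs of the Cayley graph of Z^2 *)

Definition Z2 : Type := (int * int)%type.
HB.instance Definition _ := GRing.Zmodule.on Z2.

Definition generators : seq Z2 := [:: (1, 0); (-1, 0); (0, 1); (0, -1)].

Definition adjacent (u v : Z2) : Prop := v - u \in generators.

(* The edge {u, v} is recorded as both [edge u v] and [edge v u]; nothing is
   assumed at this level, see [subgraph]. *)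
Record graph := Graph { vert : set Z2; edge : Z2 -> Z2 -> Prop }.

Definition subgraph (G : graph) : Prop :=
  (forall u v, edge G u v -> edge G v u) /\
  (forall u v, edge G u v -> [/\ adjacent u v, vert G u & vert G v]).

Fixpoint walk (G : graph) (n : nat) (u v : Z2) : Prop :=
  if n is m.+1 then exists2 w, edge G u w & walk G m w v else u = v.

Definition connected_graph (G : graph) : Prop :=
  forall u v, vert G u -> vert G v -> exists n, walk G n u v.

Definition rooted_subgraph (G : graph) : Prop :=
  [/\ subgraph G, connected_graph G, infinite_set (vert G) & vert G 0].

Definition gmap (f : Z2 -> Z2) (G : graph) : graph :=
  {| vert := f @` vert G;
     edge := fun u v => exists u' v', [/\ edge G u' v', f u' = u & f v' = v] |}.

Definition gunion (I : Type) (F : I -> graph) : graph :=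
  {| vert := \bigcup_(i in [set: I]) vert (F i);
     edge := fun u v => exists i, edge (F i) u v |}.

Definition gunion2 (G H : graph) : graph :=
  {| vert := vert G `|` vert H;
     edge := fun u v => edge G u v \/ edge H u v |}.

(* The full subgraph of Z^2 on a set of vertices. *)
Definition induced (V : set Z2) : graph :=
  {| vert := V; edge := fun u v => [/\ V u, V v & adjacent u v] |}.

Definition translate (v : Z2) (G : graph) : graph := gmap (fun z => z + v) G.

(* Multiplication by i on Z^2 = Z[i]. *)
Definition quarter (z : Z2) : Z2 := (- z.2, z.1).

(* The rotation of centre [c] and angle [k * pi / 2]. *)
Definition rotation (c : Z2) (k : nat) (z : Z2) : Z2 :=
  c + iter k quarter (z - c).

(** * The metric space of rooted subgraphs *)

(* The open ball of radius [N] about 0 in the metric graph [G].  As a set of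
   points of the plane it consists of the vertices at path distance < N and,
   since edges are segments of length 1 and [N] is an integer, of the edges with
   an end at distance < N, deprived of their other end when this is at
   distance N.  It thus amounts to the following pair. *)
Definition gball (G : graph) (N : nat) : graph :=
  let B := [set v | exists2 m, (m < N)%N & walk G m 0 v] in
  {| vert := B; edge := fun u v => edge G u v /\ (B u \/ B v) |}.

Record rsubgraph := RSubgraph {
  rgraph :> graph;
  rsubgraphP : rooted_subgraph rgraph }.

(* The parameter [R] is the field in which the distance takes its values. *)
Definition calT (R : realType) : Type := rsubgraph.

Section Metric.
Variable R : realType.
Implicit Types T U : calT R.

(* [ereal_sup set0 = -oo], hence the maximum with 0. *)
Definition agreement T U : \bar R :=
  maxe 0%E (ereal_sup
    [set (N%:R)%:E | N in [set N : nat | (1 <= N)%N /\ gball T N = gball U N]]).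

(* [expeR] is the exponential on extended reals: [expeR -oo = 0]. *)
Definition tdist T U : R := fine (expeR (- agreement T U)).

Lemma graph_eq (G H : graph) :
  vert G = vert H -> (forall u v, edge G u v <-> edge H u v) -> G = H.
Proof.
case: G H => [V E] [V' E'] /= -> EE'; congr Graph.
by apply/funext => u; apply/funext => v; apply/propext.
Qed.

Lemma rsubgraph_eq (T U : rsubgraph) : rgraph T = rgraph U -> T = U.
Proof.
case: T U => [G pG] [H pH] /= GH; case: _ / GH pH => pH.
by congr RSubgraph; exact: Prop_irrelevance.
Qed.

Lemma walk_rcons G n u v w : walk G n u v -> edge G v w -> walk G n.+1 u w.
Proof.
elim: n u => [|n IH] u /=; first by move=> -> vw; exists w.
by move=> [z uz zv] vw; exists z => //; exact: IH.
Qed.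

Lemma walk_rconsE G n u w :
  walk G n.+1 u w -> exists2 v, walk G n u v & edge G v w.
Proof.
elim: n u => [|n IH] u; first by move=> [v uv /= <-]; exists u.
by move=> [z uz /IH[v zv vw]]; exists v => //; exists z.
Qed.

Lemma walk_cat G m n u v w : walk G m u v -> walk G n v w -> walk G (m + n) u w.
Proof.
elim: m u => [|m IH] u /=; first by move=> ->.
by move=> [z uz zv] vw; exists z => //; exact: IH.
Qed.

Lemma walk_vert G n u v : subgraph G -> vert G u -> walk G n u v -> vert G v.
Proof.
move=> [_ sG]; elim: n u => [|n IH] u Gu /=; first by move=> <-.
by move=> [z /sG[_ _ Gz] zv]; exact: IH Gz zv.
Qed.

Lemma gball_walk (G H : graph) (N m : nat) v :
  gball G N = gball H N -> (m <= N)%N -> walk G m 0 v -> walk H m 0 v.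
Proof.
move=> GH; elim: m v => [//|m IH] v mN /walk_rconsE[w Gw wv].
apply: walk_rcons (IH _ (ltnW mN) Gw) _.
suff : edge (gball H N) w v by case.
by rewrite -GH /=; split => //; left; exists m.
Qed.

Lemma gball_le (G H : graph) (M N : nat) :
  (M <= N)%N -> gball G N = gball H N -> gball G M = gball H M.
Proof.
move=> MN GH.
have B v : vert (gball G M) v <-> vert (gball H M) v.
  by split=> -[m mM Gv]; exists m => //; move: Gv;
    (apply: (@gball_walk _ _ N); [|exact: ltnW (leq_trans mM MN)]).
have E (K L : graph) u v : gball K N = gball L N ->
    (vert (gball K M) u \/ vert (gball K M) v) -> edge K u v -> edge L u v.
  move=> KL uv Kuv; suff : edge (gball L N) u v by case.
  by rewrite -KL /=; split => //; case: uv => -[m mM Gv]; [left|right];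
    exists m => //; exact: leq_trans mM MN.
apply: graph_eq => [|u v]; first by apply/seteqP; split=> v /B.
by split=> -[uv Buv]; (split; [exact: E Buv uv|case: Buv => /B; tauto]).
Qed.

Lemma agreement_ge0 T U : (0 <= agreement T U)%E.
Proof. by rewrite /agreement le_max lexx. Qed.

Lemma agreement_le T U (N : nat) :
  gball T N = gball U N -> ((N%:R)%:E <= agreement T U)%E.
Proof.
move=> TU; case: N TU => [_|N TU]; first exact: agreement_ge0.
by rewrite /agreement le_max; apply/orP; right; apply: ereal_sup_ubound; exists N.+1.
Qed.

Lemma agreementP T U (N : nat) :
  (1 <= N)%N -> ((N%:R)%:E <= agreement T U)%E -> gball T N = gball U N.
Proof.
case: N => // N _; rewrite /agreement le_max => /orP[|NTU].
  by rewrite lee_fin lern0.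
have : ((N%:R)%:E < (N.+1%:R : R)%:E)%E by rewrite lte_fin ltr_nat.
move=> /lt_le_trans /(_ NTU) /ereal_sup_gt[_ [M [_ TU] <-]].
by rewrite lte_fin ltr_nat => NM; exact: gball_le TU.
Qed.

Lemma agreement_sym T U : agreement T U = agreement U T.
Proof.
congr (maxe _ (ereal_sup _)).
by apply/seteqP; split=> _ [N [N1 TU] <-]; exists N.
Qed.

Lemma agreement_ultra T U V :
  (mine (agreement T U) (agreement U V) <= agreement T V)%E.
Proof.
have H (N : nat) : (1 <= N)%N -> ((N%:R)%:E <= agreement T U)%E ->
    ((N%:R)%:E <= agreement U V)%E -> ((N%:R)%:E <= agreement T V)%E.
  move=> N1 TU UV; apply: agreement_le.
  by rewrite (agreementP N1 TU); exact: agreementP.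
rewrite ge_min; case: (leP (agreement T U) (agreement U V)) => [le|/ltW le].
  apply/orP; left; rewrite {1}/agreement ge_max agreement_ge0 /=.
  apply: ge_ereal_sup => _ [N [N1 TU] <-]; have := agreement_le TU => TU'.
  by apply: H => //; exact: le_trans le.
apply/orP; right; rewrite {1}/agreement ge_max agreement_ge0 /=.
apply: ge_ereal_sup => _ [N [N1 UV] <-]; have := agreement_le UV => UV'.
by apply: H => //; exact: le_trans le.
Qed.

Lemma tdistE T U : (tdist T U)%:E = expeR (- agreement T U).
Proof.
rewrite /tdist fineK // ge0_fin_numE ?expeR_ge0 //.
rewrite ltey expeR_eqy; have := agreement_ge0 T U.
by case: agreement.
Qed.

Lemma tdist_ge0 T U : 0 <= tdist T U.
Proof. by rewrite -lee_fin tdistE expeR_ge0. Qed.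

Lemma tdistxx T : tdist T T = 0.
Proof.
suff TTy : agreement T T = +oo%E by rewrite /tdist TTy.
apply/eqyP => _ /posnumP[A].
have [N AN] : exists N : nat, A%:num <= N%:R :> R.
  by exists (Num.truncn A%:num).+1; exact/ltW/truncnS_gt.
by apply: (@le_trans _ _ (N%:R)%:E); rewrite ?lee_fin //; exact: agreement_le.
Qed.

Lemma tdist_positivity T U : tdist T U = 0 -> T = U.
Proof.
move=> /(congr1 (@EFin R)); rewrite tdistE => /eqP.
rewrite expeR_eq0 eqe_oppLR /= => /eqP TUy.
have TU N : gball T N = gball U N.
  apply: (@gball_le _ _ _ N.+1) => //; apply: agreementP => //.
  by rewrite TUy leey.
have sV (V W : calT R) v : (forall N, gball V N = gball W N) ->
    vert V v -> exists m, walk V m 0 v /\ vert W v.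
  move=> VW Vv; case: (rsubgraphP V) => _ cV _ V0.
  case: (rsubgraphP W) => sW _ _ W0.
  case: (cV _ _ V0 Vv) => m V0v; exists m; split=> //.
  by apply: walk_vert W0 _ => //; exact: gball_walk (VW m) (leqnn m) V0v.
have sE (V W : calT R) u v : (forall N, gball V N = gball W N) ->
    edge V u v -> edge W u v.
  move=> VW uv; case: (rsubgraphP V) => -[_ sG] _ _ _.
  have [_ /(sV _ _ _ VW)[m [V0u _]] _] := sG _ _ uv.
  suff : edge (gball W m.+1) u v by case.
  by rewrite -VW /=; split => //; left; exists m.
apply: rsubgraph_eq; apply: graph_eq => [|u v].
  by apply/seteqP; split=> v /(@sV _ _ v) h; [case: (h U)|case: (h T)] => // ? [].
by split; exact: sE.
Qed.

Lemma tdist_sym T U : tdist T U = tdist U T.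
Proof. by rewrite /tdist agreement_sym. Qed.

Lemma tdist_triangle U T V : tdist T V <= tdist T U + tdist U V.
Proof.
rewrite -lee_fin EFinD; have := agreement_ultra T U V.
rewrite ge_min => /orP[] h.
  apply: (@le_trans _ _ (tdist T U)%:E).
    by rewrite !tdistE lee_expeR leeN2.
  by rewrite leeDl // lee_fin tdist_ge0.
apply: (@le_trans _ _ (tdist U V)%:E).
  by rewrite !tdistE lee_expeR leeN2.
by rewrite leeDr // lee_fin tdist_ge0.
Qed.

HB.instance Definition _ := gen_eqMixin (calT R).
HB.instance Definition _ := gen_choiceMixin (calT R).
HB.instance Definition _ := @isMetric.Build R (calT R) tdist
  tdistxx tdist_positivity tdist_sym tdist_triangle.

End Metric.

(** * The Kenyon tree *)

Definition kenyon1 : graph :=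
  gunion2 (induced [set z | z.2 = 0 /\ -1 <= z.1 <= 1])
          (induced [set z | z.1 = 0 /\ -2 <= z.2 <= 2]).

(* [v] has degree 1 and its unique edge is {v, w}. *)
Definition terminal (G : graph) (v w : Z2) : Prop :=
  edge G v w /\ forall w', edge G v w' -> w' = w.

(* Ends of the terminal edges contained in the horizontal axis. *)
Definition axis_tips (G : graph) : set Z2 :=
  [set v | exists w, [/\ terminal G v w, v.2 = 0 & w.2 = 0]].

Definition prune_axis (G : graph) : graph :=
  {| vert := vert G `\` axis_tips G;
     edge := fun u v => [/\ edge G u v, ~ axis_tips G u & ~ axis_tips G v] |}.

Definition four_copies (L : int) (G : graph) : graph :=
  gunion (fun k : 'I_4 => gmap (rotation 0 k) (translate (0, L) G)).

(* [kenyon n] is the tree $T_{n+1}$. *)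
Fixpoint kenyon (n : nat) : graph :=
  if n is m.+1 then prune_axis (four_copies (2 ^+ m.+1) (kenyon m))
  else kenyon1.

Definition kenyon_limit : graph := gunion kenyon.

(** * The coded trees *)

(* The point $\mathbf{r}(k) = e^{i k \pi / 2}$. *)
Definition direction (k : nat) : Z2 := iter k quarter (1, 0).

Definition S4 : Type := nat -> 'I_4.

Fixpoint center (alpha : S4) (n : nat) : Z2 :=
  if n is m.+1 then center alpha m + direction (alpha m) *+ (2 ^ m)%N else 0.

(* The edges of Z^2 joining [c] to a vertex of [G], with their ends.  In
   [pattern] below there is exactly one such edge. *)
Definition joining_edges (c : Z2) (G : graph) : graph :=
  let J u v := [/\ u = c, vert G v & adjacent u v] in
  {| vert := [set u | exists v, J u v \/ J v u];
     edge := fun u v => J u v \/ J v u |}.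

Fixpoint pattern (alpha : S4) (n : nat) : graph :=
  if n is m.+1 then
    let P := pattern alpha m in
    let c := center alpha m.+1 in
    gunion (fun k : 'I_4 =>
      gmap (rotation c k) (gunion2 P (joining_edges c P)))
  else induced [set 0].

Definition coded_graph (alpha : S4) : graph := gunion (pattern alpha).

(** * The graphs above are rooted subgraphs *)

Lemma adjacentE u v : adjacent u v <->
  (v.1 = u.1 /\ (v.2 = u.2 + 1 \/ v.2 = u.2 - 1)) \/
  (v.2 = u.2 /\ (v.1 = u.1 + 1 \/ v.1 = u.1 - 1)).
Proof.
case: u v => [a b] [c d]; rewrite /adjacent /generators !inE /=.
have E x y : ((c, d) - (a, b) == (x, y) :> Z2) = (c - a == x) && (d - b == y).
  by rewrite -[(c, d) - _]/(c - a, d - b) xpair_eqE.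
rewrite !E; split.
  by move=> /or4P[] /andP[/eqP ? /eqP ?]; lia.
by move=> h; apply/or4P; (case: h => -[h1 [h2|h2]];
  [constructor 3|constructor 4|constructor 1|constructor 2]);
  apply/andP; split; apply/eqP; lia.
Qed.

Lemma rotationE c (k : 'I_4) z :
  rotation c k z =
  match nat_of_ord k with
  | 0 => z
  | 1 => (c.1 + c.2 - z.2, c.2 - c.1 + z.1)
  | 2 => (2 * c.1 - z.1, 2 * c.2 - z.2)
  | _ => (c.1 - c.2 + z.2, c.1 + c.2 - z.1)
  end.
Proof.
case: c z => [a b] [x y]; rewrite /rotation.
case: k => -[|[|[|[|//]]]] /= _; rewrite /quarter /=;
  apply/eqP; rewrite xpair_eqE; apply/andP; split; apply/eqP => /=; lia.
Qed.

Definition k0 : 'I_4 := @Ordinal 4 0 isT.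
Definition k1 : 'I_4 := @Ordinal 4 1 isT.
Definition k2 : 'I_4 := @Ordinal 4 2 isT.
Definition k3 : 'I_4 := @Ordinal 4 3 isT.

Lemma rotation_adjacent c (k : 'I_4) u v :
  adjacent u v -> adjacent (rotation c k u) (rotation c k v).
Proof.
move/adjacentE => h; apply/adjacentE; rewrite !rotationE.
by case: k => -[|[|[|[|//]]]] /= _; lia.
Qed.

Lemma rotation_center c (k : 'I_4) : rotation c k c = c.
Proof.
rewrite rotationE; case: c => a b.
by case: k => -[|[|[|[|//]]]] /= _ //; congr pair; lia.
Qed.

Lemma translate_adjacent c u v : adjacent u v -> adjacent (u + c) (v + c).
Proof. by move/adjacentE => h; apply/adjacentE => /=; lia. Qed.

Lemma walk_sub G H n u v :
  (forall u v, edge G u v -> edge H u v) -> walk G n u v -> walk H n u v.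
Proof.
move=> GH; elim: n u => //= n IH u [w uw wv].
by exists w; [exact: GH|exact: IH].
Qed.

Lemma walk_gmap f G n u v : walk G n u v -> walk (gmap f G) n (f u) (f v).
Proof.
elim: n u => /= [u -> //|n IH u [w uw wv]].
by exists (f w); [exists u, w|exact: IH].
Qed.

Lemma walk_sym G n u v : subgraph G -> walk G n u v -> walk G n v u.
Proof.
move=> sG; elim: n u => [//|n IH] u [w uw /IH wv].
by apply: walk_rcons wv _; case: sG => + _; apply.
Qed.

(* Every vertex is joined to [c]. *)
Definition joined (G : graph) (c : Z2) : Prop :=
  forall v, vert G v -> exists n, walk G n v c.

Lemma joined_connected G c : subgraph G -> joined G c -> connected_graph G.
Proof.
move=> sG Gc u v /Gc[m uc] /Gc[n /(walk_sym sG) cv].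
by exists (m + n)%N; exact: walk_cat uc cv.
Qed.

Lemma joined_change G b c : subgraph G -> joined G b -> vert G c -> joined G c.
Proof.
by move=> sG /(joined_connected sG) cG Gc v Gv; exact: cG.
Qed.

Lemma subgraph_gmap f G : (forall u v, adjacent u v -> adjacent (f u) (f v)) ->
  subgraph G -> subgraph (gmap f G).
Proof.
move=> fa [sG eG]; split.
  by move=> _ _ [u [v [uv <- <-]]]; exists v, u; split=> //; exact: sG.
move=> _ _ [u [v [/eG[uv Gu Gv] <- <-]]].
by split; [exact: fa|exists u|exists v].
Qed.

Lemma joined_gmap f G c : joined G c -> joined (gmap f G) (f c).
Proof. by move=> Gc _ [v /Gc[n vc] <-]; exists n; exact: walk_gmap. Qed.

Lemma subgraph_gunion I (F : I -> graph) :
  (forall i, subgraph (F i)) -> subgraph (gunion F).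
Proof.
move=> sF; split=> u v [i].
  by case: (sF i) => sG _ /sG; exists i.
by case: (sF i) => _ eG /eG[uv Fu Fv]; split => //; exists i.
Qed.

Lemma joined_gunion I (F : I -> graph) c :
  (forall i, joined (F i) c) -> joined (gunion F) c.
Proof.
move=> Fc v [i _ /Fc[n vc]]; exists n; apply: walk_sub vc => x y xy.
by exists i.
Qed.

Lemma subgraph_gunion2 G H : subgraph G -> subgraph H -> subgraph (gunion2 G H).
Proof.
move=> [sG eG] [sH eH]; split=> u v [].
- by move/sG; left.
- by move/sH; right.
- by move/eG => [? ? ?]; split => //; left.
- by move/eH => [? ? ?]; split => //; right.
Qed.

Lemma adjacent_sym u v : adjacent u v -> adjacent v u.
Proof. by move/adjacentE => h; apply/adjacentE; lia. Qed.

Lemma subgraph_induced V : subgraph (induced V).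
Proof. by split=> u v [Vu Vv uv]; split => //; exact: adjacent_sym. Qed.

Lemma subgraph_joining c G : subgraph (joining_edges c G).
Proof.
split=> u v /=; first by case; [right|left].
move=> uv; split; last 2 first.
- by exists v.
- by exists u; case: uv; [right|left].
by case: uv => -[] // _ _ /adjacent_sym.
Qed.

Lemma subgraph_prune G : subgraph G -> subgraph (prune_axis G).
Proof.
move=> [sG eG]; split=> u v [uv Tu Tv]; first by split => //; exact: sG.
by case: (eG _ _ uv) => uv' Gu Gv; split.
Qed.

(* A shortest walk does not go through a vertex of degree 1. *)
Lemma joined_prune G : subgraph G -> ~ axis_tips G 0 -> joined G 0 ->
  joined (prune_axis G) 0.
Proof.
move=> sG T0 G0 v [/G0[n]]; elim/ltn_ind: n v => -[_ v /= -> _|n IH v]; first by exists 0%N.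
move=> [w vw wn] Tv; case: (pselect (axis_tips G w)) => [Tw|Tw]; last first.
  by case: (IH n (ltnSn n) w wn Tw) => m wm; exists m.+1; exists w.
case: n IH wn => [|n] IH /=; first by move=> w0; rewrite w0 in Tw.
move=> [z wz zn]; case: Tw => t [[_ Tw] _ _].
have zv : z = v by rewrite (Tw _ wz) (Tw v) //; case: sG => + _; apply.
by apply: (IH n) => //; rewrite -zv.
Qed.

Record kenyon_like (L : int) (G : graph) : Prop := KenyonLike {
  kl_sub : subgraph G;
  kl_joined : joined G 0;
  kl_top : edge G (0, L) (0, L - 1);
  kl_bot : edge G (0, - L) (0, - L + 1);
  kl_zero : vert G 0;
  kl_x : forall v, vert G v -> - L < v.1 < L;
  kl_y : forall v, vert G v -> - L <= v.2 <= L;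
  kl_end : forall v, vert G v -> v.2 = L \/ v.2 = - L -> v.1 = 0 }.

Lemma four_copiesE L G u : vert (four_copies L G) u ->
  exists k : 'I_4, exists2 v, vert G v & rotation 0 k (v + (0, L)) = u.
Proof. by move=> [k _ [_ [v Gv <-] <-]]; exists k, v. Qed.

Lemma four_copies_edge L G u v : edge (four_copies L G) u v <->
  exists k : 'I_4, exists a b, [/\ edge G a b, rotation 0 k (a + (0, L)) = u &
    rotation 0 k (b + (0, L)) = v].
Proof.
split=> [[k [_ [_ [[a [b [ab <- <-]]] <- <-]]]]|[k [a [b [ab <- <-]]]]].
  by exists k, a, b.
by exists k, (a + (0, L)), (b + (0, L)); split => //; exists a, b.
Qed.

Lemma pairE (u v : Z2) : u.1 = v.1 -> u.2 = v.2 -> u = v.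
Proof. by case: u v => [a b] [c d] /= -> ->. Qed.

Lemma kenyon_like_step L G : 1 < L -> kenyon_like L G ->
  kenyon_like (2 * L) (prune_axis (four_copies L G)).
Proof.
move=> L1 [sG jG top bot G0 bx bY be].
set H := four_copies L G.
have sH : subgraph H.
  apply: subgraph_gunion => k; apply: subgraph_gmap.
    exact: rotation_adjacent.
  by apply: subgraph_gmap => // u v; exact: translate_adjacent.
have eH (k : 'I_4) a b u v : edge G a b -> rotation 0 k (a + (0, L)) = u ->
    rotation 0 k (b + (0, L)) = v -> edge H u v.
  by move=> ab <- <-; apply/four_copies_edge; exists k, a, b.
have Gbot : vert G (0, - L) by case: sG => _ /(_ _ _ bot)[].
have jT : joined (translate (0, L) G) 0.
  have := joined_gmap (f := fun z => z + (0, L)) (joined_change sG jG Gbot).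
  by congr joined; apply: pairE => /=; lia.
have jH : joined H 0.
  apply: joined_gunion => k; rewrite -[X in joined _ X](rotation_center 0 k).
  exact: joined_gmap.
have H01 : edge H 0 (0, 1).
  by apply: (eH k0 _ _ _ _ bot); rewrite rotationE; apply: pairE => /=; lia.
have H02 : edge H 0 (0, -1).
  by apply: (eH k2 _ _ _ _ bot); rewrite rotationE; apply: pairE => /=; lia.
have T0 : ~ axis_tips H 0.
  by move=> [w [[_ Tw] _ _]]; have := Tw _ H01; rewrite -(Tw _ H02).
have Hx v : vert H v -> [/\ - (2 * L) <= v.1 <= 2 * L,
    v.1 = 2 * L \/ v.1 = - (2 * L) -> v.2 = 0,
    - (2 * L) <= v.2 <= 2 * L & v.2 = 2 * L \/ v.2 = - (2 * L) -> v.1 = 0].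
  move=> /four_copiesE[k [a Ga <-]].
  have := bx _ Ga; have := bY _ Ga; have := be _ Ga; rewrite rotationE.
  by case: a Ga => a b _; case: k => -[|[|[|[|//]]]] /= _ ? ? ?; split; lia.
have tip s : s = 2 * L \/ s = - (2 * L) -> vert H (s, 0) ->
    (exists2 e, e = 1 \/ e = -1 & edge H (s, 0) (s + e, 0)) ->
    axis_tips H (s, 0).
  move=> hs Hs [e he Hse]; exists (s + e, 0); split => //; split => // w sw.
  case: sH => _ aH; have [aw _ Hw] := aH _ _ sw.
  have [_ _ He] := aH _ _ Hse; move/adjacentE in aw.
  have [w1 w2 _ _] := Hx _ Hw; have [e1 _ _ _] := Hx _ He.
  by move: aw w1 w2 e1 => /=; case: w {sw Hw} => x y /= *; apply: pairE => /=; lia.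
have Htop : edge H (0, 2 * L) (0, 2 * L - 1).
  by apply: (eH k0 _ _ _ _ top); rewrite rotationE; apply: pairE => /=; lia.
have Hbot : edge H (0, - (2 * L)) (0, - (2 * L) + 1).
  by apply: (eH k2 _ _ _ _ top); rewrite rotationE; apply: pairE => /=; lia.
have Hleft : edge H (- (2 * L), 0) (- (2 * L) + 1, 0).
  by apply: (eH k1 _ _ _ _ top); rewrite rotationE; apply: pairE => /=; lia.
have Hright : edge H (2 * L, 0) (2 * L - 1, 0).
  by apply: (eH k3 _ _ _ _ top); rewrite rotationE; apply: pairE => /=; lia.
have offaxis v : v.2 <> 0 -> ~ axis_tips H v by move=> h [w []].
split.
- exact: subgraph_prune.
- exact: joined_prune.
- by split=> //; apply: offaxis => /=; lia.
- by split=> //; apply: offaxis => /=; lia.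
- by split => //; case: sH => _ /(_ _ _ H01)[].
- move=> v [Hv Tv]; have [b1 b2 _ _] := Hx _ Hv.
  suff : v.1 <> 2 * L /\ v.1 <> - (2 * L) by move: b1; lia.
  split=> h; apply: Tv; have v2 : v.2 = 0 by apply: b2; tauto.
    have -> : v = (2 * L, 0) by exact: pairE.
    apply: tip; [by left|by case: sH => _ /(_ _ _ Hright)[]|].
    by exists (-1) => //; right.
  have -> : v = (- (2 * L), 0) by exact: pairE.
  apply: tip; [by right|by case: sH => _ /(_ _ _ Hleft)[]|].
  by exists 1 => //; left.
- by move=> v [Hv _]; case: (Hx _ Hv).
- by move=> v [Hv _]; case: (Hx _ Hv).
Qed.

Lemma kenyon_like1 : kenyon_like 2 kenyon1.
Proof.
have E u v : vert kenyon1 u -> vert kenyon1 v -> adjacent u v ->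
    (u.1 = 0 /\ v.1 = 0) \/ (u.2 = 0 /\ v.2 = 0) -> edge kenyon1 u v.
  move=> Gu Gv uv h; have := uv => /adjacentE uv'.
  have {}h : (v.1 = 0 /\ u.1 = 0 /\ -2 <= u.2 <= 2 /\ -2 <= v.2 <= 2) \/
    (v.2 = 0 /\ u.2 = 0 /\ -1 <= u.1 <= 1 /\ -1 <= v.1 <= 1).
    by move: Gu Gv => /= [[]|[]] /= ? ? [[]|[]] /= ? ?; lia.
  by case: h => -[? [? [? ?]]]; [right|left].
split.
- by apply: subgraph_gunion2; exact: subgraph_induced.
- have W (n : nat) v : vert kenyon1 v -> (`|v.1| + `|v.2| = n)%N ->
      exists m, walk kenyon1 m v 0.
    elim: n v => [|n IH] v Gv nv.
      by exists 0%N; apply: pairE => /=; lia.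
    pose w : Z2 := (v.1 - sgz v.1, v.2 - sgz v.2).
    have hv : v.1 = 0 /\ -2 <= v.2 <= 2 \/ v.2 = 0 /\ -1 <= v.1 <= 1.
      by case: Gv => /=; tauto.
    have hw : vert kenyon1 w.
      by case: hv => -[v1 v2]; [right|left]; rewrite /w /= v1;
        split; rewrite ?sgz0; have := sgzP v.1; have := sgzP v.2;
        (do 2 case) => *; lia.
    have [m wm] : exists m, walk kenyon1 m w 0.
      apply: IH => //; rewrite /w /=.
      by have := sgzP v.1; have := sgzP v.2; (do 2 case) => *; lia.
    exists m.+1; exists w => //; apply: E => //.
      apply/adjacentE; rewrite /w /=.
      by have := sgzP v.1; have := sgzP v.2; (do 2 case) => *; lia.
    rewrite /w /=.
    by have := sgzP v.1; have := sgzP v.2; (do 2 case) => *; lia.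
  by move=> v Gv; exact: W Gv erefl.
- by apply: E; [right|right|apply/adjacentE => /=; lia|left].
- by apply: E; [right|right|apply/adjacentE => /=; lia|left].
- by left.
- by move=> v [[]|[]] /=; lia.
- by move=> v [[]|[]] /=; lia.
- by move=> v [[]|[]] /=; lia.
Qed.

Lemma kenyonP n : kenyon_like (2 ^+ n.+1) (kenyon n).
Proof.
elim: n => [|n IH]; first exact: kenyon_like1.
rewrite [2 ^+ n.+2]exprS; apply: kenyon_like_step => //.
by rewrite exprn_egt1.
Qed.

Lemma infinite_unbounded (V : set Z2) :
  (forall M : nat, exists2 v, V v & (M < `|v.1| + `|v.2|)%N) -> infinite_set V.
Proof.
move=> hV /finite_seqP[s Vs].
have [v] := hV (\sum_(v <- s) (`|v.1| + `|v.2|))%N.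
rewrite Vs /= => vs; rewrite ltnNge => /negP; apply.
by rewrite (big_rem v) //= leq_addr.
Qed.

Lemma kenyon_limit_rooted : rooted_subgraph kenyon_limit.
Proof.
have sK : subgraph kenyon_limit.
  by apply: subgraph_gunion => n; exact: kl_sub (kenyonP n).
split => //.
- apply: (@joined_connected _ 0) => //; apply: joined_gunion => n.
  exact: kl_joined (kenyonP n).
- apply: infinite_unbounded => M; exists (0, 2 ^+ M.+1).
    exists M => //; have /= [_] := kl_sub (kenyonP M).
    by move=> /(_ _ _ (kl_top (kenyonP M)))[].
  rewrite /= add0n abszX /=; exact: ltn_trans (ltnSn M) (ltn_expl _ _).
- by exists 0%N => //; exact: kl_zero (kenyonP 0).
Qed.

Record pattern_like (c : Z2) (L : int) (G : graph) : Prop := PatternLike {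
  pl_sub : subgraph G;
  pl_joined : joined G 0;
  pl_zero : vert G 0;
  pl_tips : forall k : 'I_4, vert G (rotation c k (c + (L - 1, 0))) }.

Lemma pattern_like_step c L (d : 'I_4) G :
  let c' := rotation c d (c + (L, 0)) in
  pattern_like c L G ->
  pattern_like c' (2 * L)
    (gunion (fun k : 'I_4 => gmap (rotation c' k) (gunion2 G (joining_edges c' G)))).
Proof.
move=> c' [sG jG G0 tips].
set H := gunion2 _ _.
have sH : subgraph H by apply: subgraph_gunion2 => //; exact: subgraph_joining.
have ctip : adjacent c' (rotation c d (c + (L - 1, 0))).
  apply: rotation_adjacent; apply/adjacentE => /=; lia.
have jH : joined H c'.
  have Hc : vert H c'.
    by right; exists (rotation c d (c + (L - 1, 0))); left; split.
  suff H0 : joined H 0 by exact: joined_change H0 Hc.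
  have JG v : vert G v -> exists n, walk H n v 0.
    by move=> /jG[n vn]; exists n; apply: walk_sub vn => x y xy; left.
  move=> v [/JG //|[w [vw|[_ /JG //]]]].
  have [_ /JG[n wn] _] := vw.
  by exists n.+1; exists w => //; right; left.
have sU : subgraph (gunion (fun k : 'I_4 => gmap (rotation c' k) H)).
  by apply: subgraph_gunion => k; apply: subgraph_gmap => //;
    exact: rotation_adjacent.
have jU : joined (gunion (fun k : 'I_4 => gmap (rotation c' k) H)) c'.
  apply: joined_gunion => k; rewrite -[X in joined _ X](rotation_center c' k).
  exact: joined_gmap.
have U0 : vert (gunion (fun k : 'I_4 => gmap (rotation c' k) H)) 0.
  by exists k0 => //; exists 0; [left|rewrite rotationE].
split => // [|k]; first exact: joined_change jU U0.
(* The tip of the pattern opposite to [d] goes to the tip of direction [k]. *)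
have [e [j He]] : exists e j : 'I_4, rotation c' k (c' + (2 * L - 1, 0)) =
    rotation c' e (rotation c j (c + (L - 1, 0))).
  rewrite /c'; case: d {c' ctip H sH jH sU jU U0} => -[|[|[|[|//]]]] ?;
    case: k => -[|[|[|[|//]]]] ?;
    [exists k2|exists k3|exists k0|exists k1
    |exists k1|exists k2|exists k3|exists k0
    |exists k0|exists k1|exists k2|exists k3
    |exists k3|exists k0|exists k1|exists k2];
    [exists k2|exists k2|exists k2|exists k2
    |exists k3|exists k3|exists k3|exists k3
    |exists k0|exists k0|exists k0|exists k0
    |exists k1|exists k1|exists k1|exists k1];
    rewrite !rotationE; apply: pairE => /=; lia.
rewrite He; exists e => //; exists (rotation c j (c + (L - 1, 0))) => //.
by left; exact: tips.
Qed.

Lemma centerS alpha n : center alpha n.+1 =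
  rotation (center alpha n) (alpha n) (center alpha n + (2 ^+ n, 0)).
Proof.
rewrite /= /direction rotationE; case: (center alpha n) => a b.
have E (x y : int) : (x, y) *+ (2 ^ n)%N = (x * 2 ^+ n, y * 2 ^+ n) :> Z2.
  have -> : 2 ^+ n = (2 ^ n)%N%:Z :> int by rewrite -natz natrX.
  elim: (2 ^ n)%N => [|m IH]; first by apply: pairE => /=; lia.
  by rewrite mulrSr IH; apply: pairE => /=; lia.
case: (alpha n) => -[|[|[|[|//]]]] /= _; rewrite E; apply: pairE => /=; lia.
Qed.

Lemma patternP alpha n :
  pattern_like (center alpha n) (2 ^+ n) (pattern alpha n).
Proof.
elim: n => [|n IH].
  split => //=; first exact: subgraph_induced.
    by move=> v /= ->; exists 0%N.
  by move=> k; rewrite -[(_ - _, _)]/(0 : Z2) addr0 rotation_center.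
have := pattern_like_step (alpha n) IH.
by rewrite -centerS -exprS.
Qed.

Lemma coded_graph_rooted alpha : rooted_subgraph (coded_graph alpha).
Proof.
have sP : subgraph (coded_graph alpha).
  by apply: subgraph_gunion => n; exact: pl_sub (patternP alpha n).
split => //.
- apply: (@joined_connected _ 0) => //; apply: joined_gunion => n.
  exact: pl_joined (patternP alpha n).
- apply: infinite_unbounded => M; pose n := M.+1; set c := center alpha n.
  have Mn : (n < 2 ^ n)%N by exact: ltn_expl.
  have E : 2 ^+ n = (2 ^ n)%N%:Z :> int by rewrite -natz natrX.
  have V (k : 'I_4) : vert (coded_graph alpha) (rotation c k (c + (2 ^+ n - 1, 0))).
    by exists n => //; exact: pl_tips (patternP alpha n) k.
  clearbody c; have := V k2; have := V k0; rewrite !rotationE /= E => v0 v2.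
  have {}Mn : (M.+1 < 2 ^ n)%N by [].
  move: (2 ^ n)%N Mn v0 v2 => L ML v0 v2.
  case: (ltnP M (absz (c.1 + (L%:Z - 1)))) => h.
    by eexists; [exact: v0|]; rewrite /=; lia.
  by eexists; [exact: v2|]; rewrite /=; lia.
- by exists 0%N.
Qed.

(** * Classes and envelopes *)

Section Classes.
Variable R : realType.

Definition kenyon_tree : calT R := RSubgraph kenyon_limit_rooted.

Definition Phi (alpha : S4) : calT R := RSubgraph (coded_graph_rooted alpha).

Definition rel_class (T : calT R) : set (calT R) :=
  [set U : calT R | exists2 v, vert T v & rgraph U = translate (- v) T].

Definition envelope (T : calT R) : set (calT R) := closure (rel_class T).

Definition ghys_kenyon : set (calT R) := envelope kenyon_tree.

End Classes.

Arguments kenyon_tree R : clear implicits.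
Arguments Phi R alpha : clear implicits.
Arguments ghys_kenyon R : clear implicits.

(* Main.v *)
(* All these trees are arithmetic.  Call [p] a site if [p = 0] or
   [p = 2 ^ k * d] with [d.1 + d.2] odd.  Then T_infinity is the full subgraph of
   Z^2 on the sites, and the pattern P_n is [x_n] plus the full subgraph on the
   diamond of the sites of l1-norm less than [2 ^ n]: the diamond of size
   [2 ^ n.+1] is cut into four diamonds of size [2 ^ n] by the lines |x| = |y|,
   on which 0 is the only site.  Moreover being a site is preserved by
   translations by [2 ^ n * d], [d.1 + d.2] odd, as far as points of norm less
   than [2 ^ n] are concerned, and a copy of a diamond is only attached to the
   rest of a tree through centers of higher level.

   Hence the balls of T_infinity are found around the centers [x_n] in a coded
   tree, and those of a coded tree in T_infinity around [2 ^ n * d - x_n], for a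
   well-chosen [d].  Conversely let a tree be a limit of T_infinity - v_N.
   If some vertex [w] is such that, for every [n], [2 ^ n] divides [w + v_N] for
   arbitrarily large [N], the tree is a translate of T_infinity; otherwise the
   pigeonhole principle applied to the directions provides a code.  Finally a
   coded tree is not a translate of T_infinity since each of its vertices is
   2-adically different from the limit of the [x_n]. *)

Require Import Defs.
From mathcomp Require Import all_boot all_order all_algebra.
From mathcomp Require Import zify.
From mathcomp Require Import boolp classical_sets functions cardinality reals.
From mathcomp Require Import constructive_ereal ereal topology exp.

Set Implicit Arguments.
Unset Strict Implicit.
Unset Printing Implicit Defensive.

Import Order.TTheory GRing.Theory Num.Theory.
Local Open Scope classical_set_scope.
Local Open Scope ring_scope.

(** * Sites and diamonds *)

Definition l1norm (p : Z2) : nat := (`|p.1| + `|p.2|)%N.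
Arguments l1norm p%_R.

Definition site (p : Z2) : Prop :=
  p = 0 \/ exists k (d : Z2), odd (l1norm d) /\ p = d *+ 2 ^ k.

Lemma mulrnZ2 (p : Z2) m : p *+ m = (p.1 * m%:Z, p.2 * m%:Z).
Proof.
elim: m => [|m IH]; first by rewrite mulr0n; apply: pairE => /=; lia.
by rewrite mulrSr IH; apply: pairE => /=; lia.
Qed.

Lemma mulrn_expS (p : Z2) n : p *+ 2 ^ n.+1 = p *+ 2 ^ n *+ 2.
Proof. by rewrite expnS mulnC mulrnA. Qed.

Lemma halve (p : Z2) : ~~ odd `|p.1| -> ~~ odd `|p.2| -> exists q, p = q *+ 2.
Proof.
move=> p1 p2; exists ((p.1 %/ 2)%Z, (p.2 %/ 2)%Z).
by rewrite mulrnZ2; apply: pairE => /=; lia.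
Qed.

Lemma site0 : site 0. Proof. by left. Qed.

Lemma site_odd p : odd (l1norm p) -> site p.
Proof. by right; exists 0%N, p. Qed.

Lemma double_inj (p q : Z2) : p *+ 2 = q *+ 2 -> p = q.
Proof. by rewrite !mulrnZ2 => -[] *; apply: pairE; lia. Qed.

Lemma site_double p : site (p *+ 2) <-> site p.
Proof.
split=> -[p0|[k [d [od pd]]]].
- by left; apply: double_inj; rewrite p0 mul0rn.
- case: k pd => [|k] pd.
    by move: od; rewrite -[d]mulr1n -pd mulrnZ2 /l1norm /=; lia.
  by right; exists k, d; split => //; apply: double_inj; rewrite -mulrn_expS.
- by left; rewrite p0 mul0rn.
- by right; exists k.+1, d; rewrite mulrn_expS pd.
Qed.

Lemma site_both_odd (p : Z2) : odd `|p.1| -> odd `|p.2| -> ~ site p.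
Proof.
move=> o1 o2 [p0|[k [d [od pd]]]]; first by rewrite p0 in o1.
case: k pd => [|k] pd.
  by move: od; rewrite -[d]mulr1n -pd /l1norm; lia.
by move: o1; rewrite pd mulrn_expS mulrnZ2 /=; lia.
Qed.

Lemma site_mul p n : site (p *+ 2 ^ n) <-> site p.
Proof. by elim: n => [//|n IH]; rewrite mulrn_expS site_double. Qed.

Lemma site_even (p : Z2) : ~~ odd (l1norm p) -> site p -> exists q, p = q *+ 2.
Proof.
rewrite /l1norm => op sp; apply: halve; apply/negP => h;
  by apply: site_both_odd sp; lia.
Qed.

Lemma l1norm_double p : l1norm (p *+ 2) = (l1norm p).*2.
Proof. by rewrite mulrnZ2 /l1norm /=; lia. Qed.

(** On the diagonals the norm is even, so such a site is twice another one, again on a diagonal; the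
    descent ends at 0. *)
Lemma site_diag p : site p -> `|p.1|%N = `|p.2|%N -> p = 0.
Proof.
have [n] := ubnP (l1norm p); elim: n p => // n IH p pn sp pp.
have [q pq] : exists q, p = q *+ 2 by apply: site_even => //; rewrite /l1norm; lia.
have [q0|q0] := eqVneq (l1norm q) 0%N.
  by rewrite pq mulrnZ2; apply: pairE; move: q0; rewrite /l1norm /=; lia.
rewrite pq (IH q) ?mul0rn //.
- by move: pn; rewrite pq l1norm_double; lia.
- by apply/site_double; rewrite -pq.
- by move: pp; rewrite pq mulrnZ2 /=; lia.
Qed.

(** A shift by a multiple of [2 ^ n.+1] keeps the parities of both coordinates. These settle the
    question unless both are even, and then everything is halved. The origin is excluded since its
    image is a site only if [d] is. *)
Lemma site_shift n (p d : Z2) : p <> 0 -> (l1norm p < 2 ^ n)%N ->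
  site (p + d *+ 2 ^ n) <-> site p.
Proof.
elim: n p => [|n IH] p p0 pn.
  by case: p0; apply: pairE; move: pn; rewrite expn0 /l1norm /=; lia.
rewrite mulrn_expS; set e := d *+ 2 ^ n.
have par : odd `|(p + e *+ 2).1| = odd `|p.1| /\ odd `|(p + e *+ 2).2| = odd `|p.2|.
  by rewrite mulrnZ2 /=; lia.
case: (boolP (odd (l1norm p))) => op.
  by split=> _; apply: site_odd; move: op par; rewrite /l1norm; lia.
case: (boolP (odd `|p.1|)) => o1.
  by split=> /site_both_odd; case; move: op par o1; rewrite /l1norm; lia.
have [q pq] : exists q, p = q *+ 2 by apply: halve => //; move: op o1; rewrite /l1norm; lia.
rewrite pq -mulrnDl !site_double; apply: IH.
  by move=> q0; apply: p0; rewrite pq q0 mul0rn.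
by move: pn; rewrite pq l1norm_double expnS; lia.
Qed.

Lemma site_shift_odd n (p d : Z2) : odd (l1norm d) -> (l1norm p < 2 ^ n)%N ->
  site (p + d *+ 2 ^ n) <-> site p.
Proof.
move=> od pn; case: (pselect (p = 0)) => [->|p0]; last exact: site_shift.
rewrite add0r site_mul; split=> _; [exact: site0|exact: site_odd].
Qed.

(** * Diamonds and their four quarters *)

Definition diamond (n : nat) : set Z2 := [set p | site p /\ (l1norm p < 2 ^ n)%N].

Lemma unit_cases (s : Z2) : l1norm s = 1%N ->
  [\/ s = (1, 0), s = (-1, 0), s = (0, 1) | s = (0, -1)].
Proof.
case: s => a b; rewrite /l1norm /= => h.
have : (a = 1 /\ b = 0) \/ (a = -1 /\ b = 0) \/ (a = 0 /\ b = 1) \/ (a = 0 /\ b = -1) by lia.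
by case=> [[-> ->]|[[-> ->]|[[-> ->]|[-> ->]]]];
  [constructor 1|constructor 2|constructor 3|constructor 4].
Qed.

Lemma unit_mul (s : Z2) m : l1norm s = 1%N -> l1norm (s *+ m) = m.
Proof. by case/unit_cases=> ->; rewrite mulrnZ2 /l1norm /=; lia. Qed.

Lemma diamond_shiftE n (s p : Z2) : l1norm s = 1%N ->
  diamond n (p - s *+ 2 ^ n) <-> site p /\ (l1norm (p - s *+ 2 ^ n) < 2 ^ n)%N.
Proof.
move=> s1; rewrite /diamond /=.
case: (ltnP (l1norm (p - s *+ 2 ^ n)) (2 ^ n)) => h; last by split=> -[].
have := @site_shift_odd n _ s _ h; rewrite subrK s1 => /(_ isT).
by move=> hs; split=> -[/hs].
Qed.

(** A nonzero site is off the diagonals; its coordinate of larger absolute value, with its sign,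
    gives [s]. *)
Lemma diamond_quarter n p : diamond n.+1 p -> p <> 0 ->
  exists2 s, l1norm s = 1%N & diamond n (p - s *+ 2 ^ n).
Proof.
move=> [sp pn] p0; have pp : `|p.1|%N <> `|p.2|%N by move=> /(site_diag sp).
have [s s1 ps] : exists2 s : Z2, l1norm s = 1%N & (l1norm (p - s *+ 2 ^ n) < 2 ^ n)%N.
  move: pn pp; rewrite expnS /l1norm; move: (2 ^ n)%N => L pn pp.
  have : [\/ `|p.2|%:Z < p.1, `|p.2|%:Z < - p.1, `|p.1|%:Z < p.2 | `|p.1|%:Z < - p.2].
    have : [|| `|p.2|%:Z < p.1, `|p.2|%:Z < - p.1, `|p.1|%:Z < p.2 | `|p.1|%:Z < - p.2] by lia.
    by case/or4P => ?; [constructor 1|constructor 2|constructor 3|constructor 4].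
  case=> h; [exists (1, 0)|exists (-1, 0)|exists (0, 1)|exists (0, -1)] => //;
    by rewrite mulrnZ2 /=; lia.
by exists s => //; apply/(@diamond_shiftE n s p s1).
Qed.

Lemma quarter_diamond n s p : l1norm s = 1%N -> diamond n (p - s *+ 2 ^ n) ->
  diamond n.+1 p /\ p <> 0.
Proof.
move=> s1 /(@diamond_shiftE n s p s1)[sp ps]; split; last first.
  move=> p0; move: ps; rewrite p0 sub0r /l1norm.
  by case/unit_cases: s1 => ->; rewrite mulrnZ2 /=; lia.
split => //; move: ps; rewrite expnS /l1norm.
by case/unit_cases: s1 => ->; rewrite mulrnZ2 /=; lia.
Qed.

(** A step changes [x + y] and [x - y] by 1, so it cannot cross a diagonal without stopping on it,
    where 0 is the only site. *)
Lemma quarter_adjacent n s p q : l1norm s = 1%N -> diamond n (p - s *+ 2 ^ n) ->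
  diamond n.+1 q -> q <> 0 -> adjacent p q -> diamond n (q - s *+ 2 ^ n).
Proof.
move=> s1 /(@diamond_shiftE n s p s1)[sp ps] [sq qn] q0 /adjacentE pq.
apply/(@diamond_shiftE n s q s1); split => //.
have qq : `|q.1|%N <> `|q.2|%N by move=> /(site_diag sq).
move: qn ps; rewrite expnS /l1norm; move: pq qq.
by case/unit_cases: s1 => ->; rewrite mulrnZ2 /=; lia.
Qed.

(** * Patterns *)

Definition turn (k : nat) (p : Z2) : Z2 := iter k quarter p.

Lemma turnS k p : turn k.+1 p = quarter (turn k p). Proof. by []. Qed.

Lemma turnB k p q : turn k (p - q) = turn k p - turn k q.
Proof.
elim: k => [//|k IH]; rewrite !turnS IH; apply: pairE => /=; lia.
Qed.

Lemma turnMn k p m : turn k (p *+ m) = turn k p *+ m.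
Proof.
by elim: k => [//|k IH]; rewrite !turnS IH !mulrnZ2; apply: pairE => /=; lia.
Qed.

Lemma turn0 k : turn k 0 = 0.
Proof. by rewrite -[0](subrr 0) turnB !subrr. Qed.

Lemma l1norm_turn k p : l1norm (turn k p) = l1norm p.
Proof. by elim: k => [//|k <-]; rewrite turnS /l1norm /=; lia. Qed.

Lemma l1normN p : l1norm (- p) = l1norm p.
Proof. by rewrite /l1norm /=; lia. Qed.

Lemma turnK (k : 'I_4) p : turn (4 - k) (turn k p) = p.
Proof. by rewrite /turn -iterD subnK ?(ltnW (ltn_ord k)) //; apply: pairE => /=; lia. Qed.

Lemma turnVK (k : 'I_4) p : turn k (turn (4 - k) p) = p.
Proof. by rewrite /turn -iterD subnKC ?(ltnW (ltn_ord k)) //; apply: pairE => /=; lia. Qed.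

Lemma site_turn k p : site p -> site (turn k p).
Proof.
case=> [->|[m [d [od ->]]]]; first by rewrite turn0; left.
by right; exists m, (turn k d); rewrite l1norm_turn turnMn.
Qed.

Lemma diamond_turn (k : 'I_4) n p : diamond n (turn k p) <-> diamond n p.
Proof.
split=> -[sp pn]; split; rewrite ?l1norm_turn //; last exact: site_turn.
  by rewrite -(turnK k p); exact: site_turn.
by move: pn; rewrite l1norm_turn.
Qed.

Lemma turn_unit (s t : Z2) : l1norm s = 1%N -> l1norm t = 1%N ->
  exists k : 'I_4, turn k s = t.
Proof.
by case/unit_cases=> ->; case/unit_cases=> ->;
  ((by exists k0) || (by exists k1) || (by exists k2) || (by exists k3)).
Qed.

Lemma rotation_turn c (k : nat) z : rotation c k z = c + turn k (z - c).
Proof. by []. Qed.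

Lemma rotationB c (k : nat) z : rotation c k z - c = turn k (z - c).
Proof. by rewrite rotation_turn addrAC subrr add0r. Qed.

Lemma rotation_surj c (k : 'I_4) p : exists q, rotation c k q = p.
Proof.
exists (c + turn (4 - k) (p - c)).
by rewrite rotation_turn addrAC subrr add0r turnVK addrC subrK.
Qed.

Lemma rotation_adjacent_inv c (k : 'I_4) u v :
  adjacent (rotation c k u) (rotation c k v) -> adjacent u v.
Proof.
move/adjacentE => h; apply/adjacentE; move: h; rewrite !rotationE.
by case: k => -[|[|[|[|//]]]] /= _; lia.
Qed.

(** A union of full subgraphs need not be full; it is when every edge of the whole lies in one of
    the four copies. This serves both for the patterns and for the Kenyon trees. *)
Lemma gunion_rotation c (W Z : set Z2) :
  (forall p, Z p <-> exists k : 'I_4, exists2 q, W q & rotation c k q = p) ->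
  (forall p p', Z p -> Z p' -> adjacent p p' -> exists (k : 'I_4) q q',
    [/\ W q, W q', rotation c k q = p & rotation c k q' = p']) ->
  gunion (fun k : 'I_4 => gmap (rotation c k) (induced W)) = induced Z.
Proof.
move=> ZW adj; apply: graph_eq => [|u v].
  apply/seteqP; split=> p /=; first by move=> [k _ pW]; apply/ZW; exists k.
  by move=> /ZW[k pW]; exists k.
split=> [[k [p [q [[Wp Wq pq] <- <-]]]]|[Zu Zv uv]].
  by split; [apply/ZW; exists k, p|apply/ZW; exists k, q|exact: rotation_adjacent].
have [k [q [q' [Wq Wq' qu qv]]]] := adj _ _ Zu Zv uv.
exists k, q, q'; split => //; split => //.
by apply: (@rotation_adjacent_inv c k); rewrite qu qv.
Qed.

Lemma adjacent_shift u v c : adjacent (u - c) (v - c) <-> adjacent u v.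
Proof. by split=> /adjacentE /= h; apply/adjacentE => /=; lia. Qed.

Lemma adjacent0 p : adjacent 0 p <-> l1norm p = 1%N.
Proof.
rewrite /l1norm; split=> [/adjacentE /= h|h]; first lia.
by apply/adjacentE => /=; lia.
Qed.

Lemma adjacent_parity p q : adjacent p q -> odd (l1norm p) = ~~ odd (l1norm q).
Proof. by move/adjacentE; rewrite /l1norm; lia. Qed.

Lemma unit_direction (k : nat) : l1norm (direction k) = 1%N.
Proof. by rewrite /direction -/(turn k _) l1norm_turn. Qed.

(** Seen from [center alpha n.+1], the diamond about [center alpha n] is the quarter of direction
    [- direction (alpha n)]. *)
Lemma diamond_center_step alpha n p :
  diamond n (p - center alpha n) -> diamond n.+1 (p - center alpha n.+1) /\
    p <> center alpha n.+1.
Proof.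
move=> h; have [||dp pc] := @quarter_diamond n (- direction (alpha n)) (p - center alpha n.+1).
- by rewrite l1normN unit_direction.
- by rewrite /= mulNrn opprK opprD addrA subrK.
- by split => // pp; apply: pc; rewrite pp subrr.
Qed.

Lemma diamond_turn_shift (k : 'I_4) n s p :
  diamond n (turn k p - turn k s *+ 2 ^ n) <-> diamond n (p - s *+ 2 ^ n).
Proof. by rewrite -turnMn -turnB diamond_turn. Qed.

Lemma patternE alpha n :
  pattern alpha n = induced [set p | diamond n (p - center alpha n)].
Proof.
elim: n => [|n IH].
  congr induced; apply/seteqP; split=> p /=; rewrite subr0.
    by move=> ->; split; [exact: site0|].
  by move=> [_]; rewrite expn0 /l1norm => p0; apply: pairE => /=; lia.
move: IH; set x := center alpha n => IH; set c := center alpha n.+1.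
set s : Z2 := - direction (alpha n).
have s1 : l1norm s = 1%N by rewrite l1normN unit_direction.
(* The vertices of one of the four pieces: the previous pattern and the new centre. *)
pose W : set Z2 := [set q | diamond n (q - c - s *+ 2 ^ n) \/ q = c].
have xc q : q - x = q - c - s *+ 2 ^ n.
  by rewrite /c /= mulNrn opprK opprD addrA subrK.
have Wc q : W (c + q) <-> diamond n (q - s *+ 2 ^ n) \/ q = 0.
  rewrite /W /= [c + q]addrC addrK; split=> -[]; try by left.
    by move=> h; right; apply: (addIr c); rewrite h add0r.
  by move=> ->; right; rewrite add0r.
(* [c + q0] is a vertex of the previous pattern adjacent to [c]; it makes [c] a vertex of
   [joining_edges]. *)
have [q0 q0P q01] : exists2 q0, diamond n (q0 - s *+ 2 ^ n) & l1norm q0 = 1%N.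
  exists s => //; apply/(@diamond_shiftE n s s s1); split; first by apply: site_odd; rewrite s1.
  by case/unit_cases: s1 => ->; rewrite mulrnZ2 /l1norm /=; have := expn_gt0 2 n; lia.
have -> : pattern alpha n.+1 =
    gunion (fun k : 'I_4 => gmap (rotation c k) (induced W)).
  have -> : induced W = gunion2 (pattern alpha n) (joining_edges c (pattern alpha n)).
    rewrite IH; apply: graph_eq => [|u v].
      apply/seteqP; split=> p /=; rewrite !xc.
        case=> [?|->]; first by left.
        right; exists (c + q0); left; split => //.
          by rewrite /= xc [c + q0]addrC addrK.
        by apply/(@adjacent_shift _ _ c); rewrite subrr addrAC subrr add0r; apply/adjacent0.
      case=> [?|[q [[-> _ _]|[_ + _]]]]; last 1 first.
      + by left.
      + by left.
      by right.
    split=> /=; rewrite !xc.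
      move=> [[hu|->] [hv|->] uv].
      + by left.
      + by right; right; split => //; exact: adjacent_sym.
      + by right; left.
      + by move/adjacentE: uv; lia.
    by case=> [[hu hv uv]|[[-> hv uv]|[-> hu /adjacent_sym uv]]]; split => //;
      by [left|right].
  by [].
apply: gunion_rotation => [p|p p' dp dp' pp'].
  rewrite /=; split=> [dp|[k [q Wq <-]]].
    case: (pselect (p - c = 0)) => [pc0|pc0].
      by exists k0, c; [right|rewrite rotation_center -[p](subrK c) pc0 add0r].
    have [t t1 pt] := diamond_quarter dp pc0.
    have [k kt] := turn_unit s1 t1; exists k.
    have [q qp] := rotation_surj c k p; exists q => //.
    rewrite -[q](subrK c) addrC; apply/Wc; left.
    apply/(diamond_turn_shift k); rewrite kt.
    by rewrite -qp rotationB in pt.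
  rewrite rotationB; apply/diamond_turn.
  case: Wq => [/(quarter_diamond s1)[]//|->]; rewrite subrr.
  by split; [exact: site0|rewrite expn_gt0].
(* An edge with one end in a quarter and the other in the same quarter or at [c] comes from a single
   copy; every edge reduces to this case. *)
have key (z z' : Z2) (k : 'I_4) : diamond n (z - c - turn k s *+ 2 ^ n) ->
    diamond n (z' - c - turn k s *+ 2 ^ n) \/ z' = c ->
    exists q q', [/\ W q, W q', rotation c k q = z & rotation c k q' = z'].
  have W1 y q : rotation c k q = y -> diamond n (y - c - turn k s *+ 2 ^ n) -> W q.
    move=> <-; rewrite rotationB.
    by move/diamond_turn_shift; left.
  have [q qz] := rotation_surj c k z; have [q' qz'] := rotation_surj c k z'.
  move=> hz [hz'|zc]; first by exists q, q'; split => //; [exact: W1 qz _|exact: W1 qz' _].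
  by exists q, c; split => //; [exact: W1 qz _|right|rewrite rotation_center zc].
case: (pselect (p - c = 0)) => [pc0|pc0].
  have pc : p = c by rewrite -[p](subrK c) pc0 add0r.
  have p'c : p' - c <> 0.
    by move=> h; move/adjacentE: pp'; rewrite -[p'](subrK c) h pc add0r; lia.
  have [t t1 pt] := diamond_quarter dp' p'c; have [k kt] := turn_unit s1 t1.
  by have [||q [q' []]] := key p' p k; rewrite ?kt //; [right|exists k, q', q].
have [t t1 pt] := diamond_quarter dp pc0; have [k kt] := turn_unit s1 t1.
have [||q [q' qP]] := key p p' k; rewrite ?kt //; last by exists k, q, q'.
case: (pselect (p' - c = 0)) => [pc'|pc'].
  by right; rewrite -[p'](subrK c) pc' add0r.
left; apply: (quarter_adjacent t1 pt dp' pc').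
exact/adjacent_shift.
Qed.

(** * The Kenyon tree *)

(** The two corners of the closed diamond that survive the pruning. *)
Definition segment_ends (n : nat) : set Z2 :=
  [set p | p = (0, 1) *+ 2 ^ n \/ p = (0, -1) *+ 2 ^ n].

(** Only one neighbour of a corner has smaller norm, the next point inwards on the axis, and it lies
    in the quarter of that corner. *)
Lemma tip_adjacent n s p : l1norm s = 1%N -> diamond n.+1 p ->
  adjacent p (s *+ 2 ^ n.+1) -> diamond n (p - s *+ 2 ^ n).
Proof.
move=> s1 [sp pn] /adjacentE ps; apply/(@diamond_shiftE n s p s1); split => //.
move: ps pn (expn_gt0 2 n); rewrite expnS /l1norm.
by case/unit_cases: s1 => ->; rewrite !mulrnZ2 /=; lia.
Qed.

Lemma four_copies_induced n :
  four_copies (2 ^+ n) (induced (diamond n `|` segment_ends n)) =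
  induced (diamond n.+1 `|` [set p | exists2 s, l1norm s = 1%N & p = s *+ 2 ^ n.+1]).
Proof.
set Z := _ `|` [set p | exists2 s, _ & _].
pose e : Z2 := (0, 1); have e1 : l1norm e = 1%N by [].
(* [W t] is the copy of centre [t *+ 2 ^ n]: its diamond, its outer corner, and its inner corner 0
   where the four copies meet. *)
pose W (t : Z2) : set Z2 :=
  [set q | [\/ diamond n (q - t *+ 2 ^ n), q = t *+ 2 ^ n.+1 | q = 0]].
have eL : (0, 2 ^+ n) = e *+ 2 ^ n :> Z2.
  by rewrite mulrnZ2; apply: pairE; rewrite /= ?mul0r ?mul1r // -natz natrX.
have WK q : W e q <-> (diamond n `|` segment_ends n) (q - e *+ 2 ^ n).
  have -> : q = q - e *+ 2 ^ n + e *+ 2 ^ n by rewrite subrK.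
  move: (q - _) => {}q; rewrite addrK; split=> [[|qe|qe]|[|[qe|qe]]]; rewrite ?addrK.
  - by left.
  - by right; left; apply: (addIr (e *+ 2 ^ n)); rewrite qe expnS mul2n -addnn mulrnDr.
  - by right; right; apply: (addIr (e *+ 2 ^ n)); rewrite qe !mulrnZ2; apply: pairE => /=; lia.
  - by constructor 1; rewrite addrK.
  - by constructor 2; rewrite qe expnS mul2n -addnn mulrnDr.
  - by constructor 3; rewrite qe !mulrnZ2; apply: pairE => /=; lia.
have We_turn (k : 'I_4) t q : W (turn k t) (turn k q) <-> W t q.
  rewrite /W /=; split=> -[h|h|h].
  - by constructor 1; apply/(diamond_turn_shift k).
  - by constructor 2; rewrite -(turnK k q) h -turnMn turnK.
  - by constructor 3; rewrite -(turnK k q) h turn0.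
  - by constructor 1; apply/(diamond_turn_shift k).
  - by constructor 2; rewrite h turnMn.
  - by constructor 3; rewrite h turn0.
have -> : four_copies (2 ^+ n) (induced (diamond n `|` segment_ends n)) =
    gunion (fun k : 'I_4 => gmap (rotation 0 k) (induced (W e))).
  rewrite /four_copies eL; congr gunion; apply/funext => k; congr gmap.
  apply: graph_eq => [|u v].
    apply/seteqP; split=> p /=; first by move=> [q Kq <-]; apply/WK; rewrite addrK.
    by move=> /WK h; exists (p - e *+ 2 ^ n) => //; rewrite subrK.
  split=> /= [[p [q [[Kp Kq pq] <- <-]]]|[/WK Wu /WK Wv uv]].
    by split; [apply/WK; rewrite addrK|apply/WK; rewrite addrK|exact: translate_adjacent].
  exists (u - e *+ 2 ^ n), (v - e *+ 2 ^ n); rewrite !subrK; split => //; split => //.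
  exact/adjacent_shift.
have W0 t : W t 0 by constructor 3.
have ZW p : Z p <-> exists2 t, l1norm t = 1%N & W t p.
  split=> [[dp|[s s1 ->]]|[t t1 [h|->|->]]].
  - case: (pselect (p = 0)) => [->|p0]; first by exists e.
    by have [s s1 ps] := diamond_quarter dp p0; exists s => //; constructor 1.
  - by exists s => //; constructor 2.
  - by left; case: (quarter_diamond t1 h).
  - by right; exists t.
  - by left; split; [exact: site0|rewrite expn_gt0].
have tip0 s : l1norm s = 1%N -> ~ adjacent 0 (s *+ 2 ^ n.+1).
  by move=> s1 /adjacent0; rewrite unit_mul // expnS; lia.
have half p p' : Z p -> Z p' -> p <> 0 -> adjacent p p' -> diamond n.+1 p ->
    exists2 t, l1norm t = 1%N & W t p /\ W t p'.
  move=> Zp Zp' p0 pp' dp.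
  case: Zp' => [dp'|[s s1 p's]].
    have [s s1 ps] := diamond_quarter dp p0; exists s => //; split; first by constructor 1.
    case: (pselect (p' = 0)) => [->|p'0]; first exact: W0.
    by constructor 1; exact: quarter_adjacent ps dp' p'0 pp'.
  exists s => //; split; last by constructor 2.
  by constructor 1; apply: tip_adjacent => //; rewrite -p's.
have ZWW p p' : Z p -> Z p' -> adjacent p p' ->
    exists2 t, l1norm t = 1%N & W t p /\ W t p'.
  move=> Zp Zp' pp'; case: (pselect (p = 0)) => [->|p0].
    by have /ZW[t t1 Wt] := Zp'; exists t.
  case: (Zp) => [dp|[s s1 ps]]; first exact: half.
  case: (Zp') => [dp'|[s' s'1 ps']].
    case: (pselect (p' = 0)) => [->|p'0].
      by have /ZW[t t1 Wt] := Zp; exists t.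
    by have [t t1 [Wt Wt']] := half _ _ Zp' Zp p'0 (adjacent_sym pp') dp'; exists t.
  (* Two corners have the same norm, whereas adjacent points have norms of opposite parities. *)
  by have := adjacent_parity pp'; rewrite ps ps' !unit_mul // expnS; lia.
apply: gunion_rotation => [p|p p' Zp Zp' pp'].
  split=> [/ZW[t t1 Wt]|[k [q Wq <-]]].
    have [k kt] := turn_unit e1 t1; have [q qp] := rotation_surj 0 k p.
    exists k; exists q => //; apply/(We_turn k); rewrite kt.
    by rewrite -qp rotation_turn subr0 add0r in Wt.
  apply/ZW; exists (turn k e); first by rewrite l1norm_turn.
  by rewrite rotation_turn subr0 add0r; apply/We_turn.
have [t t1 [Wt Wt']] := ZWW _ _ Zp Zp' pp'.
have [k kt] := turn_unit e1 t1; have [q qp] := rotation_surj 0 k p.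
have [q' qp'] := rotation_surj 0 k p'; exists k, q, q'; move: (qp) (qp').
by rewrite !rotation_turn !subr0 !add0r => qt qt'; split => //;
  apply/(We_turn k); rewrite kt ?qt ?qt'.
Qed.

(** Halving leads to 0 or to an odd abscissa. Hence the horizontal axis is filled between the
    corners, and only these can be pruned. *)
Lemma site_axis a : site (a, 0).
Proof.
have [m] := ubnP `|a|%N; elim: m a => // m IH a am.
case: (boolP (odd `|a|)) => oa; first by apply: site_odd; rewrite /l1norm /= addn0.
case: (eqVneq a 0) => [->|a0]; first exact: site0.
have -> : (a, 0) = ((a %/ 2)%Z, 0) *+ 2 :> Z2 by rewrite mulrnZ2; apply: pairE => /=; lia.
by apply/site_double; apply: IH; lia.
Qed.

Lemma prune_axis_induced n :
  prune_axis (induced (diamond n `|` [set p | exists2 s, l1norm s = 1%N & p = s *+ 2 ^ n])) =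
  induced (diamond n `|` segment_ends n).
Proof.
set Z := _ `|` _; have L0 := expn_gt0 2 n.
have Zaxis a : (`|a| <= 2 ^ n)%N -> Z (a, 0).
  move=> an; case: (ltnP `|a| (2 ^ n)) => h.
    by left; split; [exact: site_axis|rewrite /l1norm /=; lia].
  right; exists (sgz a, 0); first by rewrite /l1norm /=; case: (sgzP a) h => *; lia.
  by rewrite mulrnZ2; apply: pairE => //=; case: (sgzP a) h => *; lia.
have Zl1 p : Z p -> (l1norm p <= 2 ^ n)%N.
  by move=> [[_ /ltnW]|[s s1 ->]] //; rewrite unit_mul.
have tipsE v : axis_tips (induced Z) v <-> v.2 = 0 /\ `|v.1|%N = (2 ^ n)%N.
  split=> [[w [[[Zv Zw vw] tw] v2 w2]]|[v2 v1]].
    split => //; have := Zl1 _ Zv; rewrite /l1norm v2 addn0 leq_eqVlt => /orP[/eqP //|v1].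
    (* Strictly between the corners both horizontal neighbours are present, and terminality would
       make both equal to [w]. *)
    have E b : b = 1 \/ b = -1 -> w = (v.1 + b, 0).
      move=> hb; rewrite (tw (v.1 + b, 0)) //; split => //; first by apply: Zaxis; lia.
      by apply/adjacentE => /=; lia.
    have := E (-1); rewrite (E 1); last by left.
    by move=> /(_ (or_intror erefl)) []; lia.
  have vE : v = (v.1, 0) by case: (v) v2 => ? ? /= ->.
  exists (v.1 - sgz v.1, 0); split => //; split.
    split; [rewrite vE; apply: Zaxis; lia|apply: Zaxis|apply/adjacentE => /=];
      case: (sgzP v.1) v1 => *; lia.
  (* From a corner, every step but the inward one makes the norm exceed [2 ^ n]. *)
  move=> w [_ /Zl1 + /adjacentE]; rewrite /l1norm => wn vw.
  by apply: pairE => /=; case: (sgzP v.1) v1 => *; lia.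
have KZ p : (diamond n `|` segment_ends n) p <-> Z p /\ ~ axis_tips (induced Z) p.
  split=> [[dp|pe]|[[dp|[s s1 ps]] tp]].
  - split; [by left|move=> /tipsE[p2 p1]].
    by case: dp => _; rewrite /l1norm p2 p1; lia.
  - split; first by right; case: pe => ->; [exists (0, 1)|exists (0, -1)].
    by move=> /tipsE; case: pe => ->; rewrite mulrnZ2 /=; lia.
  - by left.
  - right; move: tp; rewrite ps; case/unit_cases: s1 => -> tp; [| |by left|by right];
      by case: tp; apply/tipsE; rewrite mulrnZ2 /=; lia.
apply: graph_eq => [|u v]; first by apply/seteqP; split=> p /KZ.
split=> [[[Zu Zv uv] tu tv]|[/KZ[Zu tu] /KZ[Zv tv] uv]].
  by split => //; apply/KZ.
by split.
Qed.

Lemma kenyonE n : kenyon n = induced (diamond n.+1 `|` segment_ends n.+1).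
Proof.
elim: n => [|n IH]; last first.
  by rewrite [LHS]/= IH four_copies_induced prune_axis_induced.
(* Base case: the sites of norm less than 2 are 0 and its four neighbours, to which the ends
   [(0, 2)] and [(0, -2)] are added. *)
have KE p : (diamond 1 `|` segment_ends 1) p <->
    (p.2 = 0 /\ -1 <= p.1 <= 1) \/ (p.1 = 0 /\ -2 <= p.2 <= 2).
  split=> [[[_]|[->|->]]|hp].
  - by rewrite expn1 /l1norm; lia.
  - by right; rewrite mulrnZ2 /=; lia.
  - by right; rewrite mulrnZ2 /=; lia.
  case: (ltnP (l1norm p) 2) => [pn|pn].
    left; split => //; case: (eqVneq (l1norm p) 0%N) => p0.
      by left; apply: pairE; move: p0; rewrite /l1norm /=; lia.
    by apply: site_odd; move: pn p0; case: (l1norm p) => [|[|]].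
  right; rewrite /segment_ends /= !mulrnZ2; move: pn; rewrite /l1norm => pn.
  have : p.1 = 0 /\ (p.2 = 2 \/ p.2 = -2) by lia.
  by move=> [p1 [p2|p2]]; [left|right]; apply: pairE => /=; lia.
apply: graph_eq => [|u v].
  by apply/seteqP; split=> p /=; move=> h; [apply/KE|move/KE: h] => //; case: h; tauto.
split=> /= [[]|].
- by move=> [? ? ?]; split => //; apply/KE; left.
- by move=> [? ? ?]; split => //; apply/KE; right.
move=> [/KE hu /KE hv uv].
have := uv => /adjacentE uv'.
have [h|h] : ((u.2 = 0 /\ -1 <= u.1 <= 1) /\ (v.2 = 0 /\ -1 <= v.1 <= 1)) \/
   ((u.1 = 0 /\ -2 <= u.2 <= 2) /\ (v.1 = 0 /\ -2 <= v.2 <= 2)) by lia.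
  by left; case: h.
by right; case: h.
Qed.

(** A site of norm at most [n] lies in [kenyon n], as [n < 2 ^ n.+1]; the two ends of an edge are
    given a common index. *)
Lemma kenyon_limitE : kenyon_limit = induced site.
Proof.
have Ks n p : vert (kenyon n) p -> site p.
  by rewrite kenyonE /= => -[[]|[->|->]] //; apply/site_mul; exact: site_odd.
have sK p n : site p -> (l1norm p <= n)%N -> vert (kenyon n) p.
  move=> sp pn; rewrite kenyonE; left; split => //.
  by apply: leq_ltn_trans pn _; apply: ltn_trans (ltnSn n) (ltn_expl _ _).
apply: graph_eq => [|u v].
  apply/seteqP; split=> p /=; first by move=> [n _ /Ks].
  by move=> sp; exists (l1norm p) => //; exact: sK.
split=> /= [[n]|[su sv uv]].
  by have := @Ks n; rewrite kenyonE => K [/K su /K sv uv].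
exists (l1norm u + l1norm v)%N; have := sK _ (l1norm u + l1norm v)%N su.
have := sK _ (l1norm u + l1norm v)%N sv; rewrite kenyonE /= => hv hu.
by split; [apply: hu; exact: leq_addr|apply: hv; exact: leq_addl|].
Qed.

(** * Balls and envelopes *)

Lemma translateE v G : translate (- v) G =
  Graph [set p | vert G (p + v)] (fun p q => edge G (p + v) (q + v)).
Proof.
apply: graph_eq => [|p q].
  apply/seteqP; split=> p /=; first by move=> [q Gq <-]; rewrite subrK.
  by move=> Gp; exists (p + v) => //; rewrite addrK.
split=> /= [[p' [q' [pq <- <-]]]|pq]; first by rewrite !subrK.
by exists (p + v), (q + v); rewrite !addrK.
Qed.

Lemma translate_translate v w G :
  translate (- w) (translate (- v) G) = translate (- (w + v)) G.
Proof.
rewrite !translateE; apply: graph_eq => [|p q] /=; last by rewrite !addrA.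
by apply/seteqP; split=> p /=; rewrite addrA.
Qed.

Lemma translate0 G : translate (- 0) G = G.
Proof.
rewrite translateE; apply: graph_eq => [|u v] /=; last by rewrite !addr0.
by apply/seteqP; split=> p /=; rewrite addr0.
Qed.

Lemma translate_induced v (W : set Z2) :
  translate (- v) (induced W) = induced [set p | W (p + v)].
Proof.
rewrite translateE; apply: graph_eq => // p q /=.
have := adjacent_shift (p + v) (q + v) v; rewrite !addrK => pq.
by split=> -[Wp Wq /pq].
Qed.

Lemma translate_rooted v G :
  rooted_subgraph G -> vert G v -> rooted_subgraph (translate (- v) G).
Proof.
move=> [sG cG iG G0] Gv.
have sT : subgraph (translate (- v) G).
  by apply: subgraph_gmap => // p q; exact: translate_adjacent.
split => //.
- apply: (@joined_connected _ (v - v)) => //; apply: joined_gmap.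
  by move=> w Gw; exact: cG.
- move=> /(finite_image (fun p => p + v)) h; apply: iG; apply: sub_finite_set h.
  by move=> p Gp; exists (p - v); [exists p|rewrite subrK].
- by exists v => //; rewrite subrr.
Qed.

Lemma walk_translate v G n p q :
  walk (translate (- v) G) n p q <-> walk G n (p + v) (q + v).
Proof.
rewrite translateE; elim: n p => [|n IH] p /=.
  by split=> [->//|/addIr].
split=> -[w pw wq].
  by exists (w + v) => //; apply/IH.
by exists (w - v); rewrite ?subrK //; apply/IH; rewrite subrK.
Qed.

Lemma walk_l1norm G n p q : subgraph G -> walk G n p q -> (l1norm (q - p) <= n)%N.
Proof.
move=> [_ sG]; elim: n p => [|n IH] p /=; first by move=> ->; rewrite subrr.
move=> [w /sG[/adjacentE pw _ _] /IH].
by rewrite /l1norm /=; lia.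
Qed.

(** By induction on the length, walks from 0 reach the same vertices in both graphs, so edges need
    only be compared at vertices reached in both. *)
Lemma gball_local (G H : graph) N : subgraph G -> subgraph H ->
  (forall m u w, (m < N)%N -> walk G m 0 u -> walk H m 0 u ->
     edge G u w <-> edge H u w) ->
  gball G N = gball H N.
Proof.
move=> sG sH GH.
have W m u : (m <= N)%N -> walk G m 0 u <-> walk H m 0 u.
  elim: m u => [//|m IH] u mN.
  have {}IH w := IH w (ltnW mN).
  by split=> /walk_rconsE[w mw wu]; apply: (@walk_rcons _ _ _ w);
    [exact/IH|apply/(GH m) => //; exact/IH|exact/IH|apply/(GH m) => //; exact/IH].
have B u : vert (gball G N) u <-> vert (gball H N) u.
  by split=> -[m mN mu]; exists m => //; apply/(W _ _ (ltnW mN)).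
have E u v : vert (gball G N) u -> edge G u v <-> edge H u v.
  by move=> [m mN mu]; apply: (GH m) => //; apply/(W _ _ (ltnW mN)).
have sym K u v : subgraph K -> edge K u v <-> edge K v u.
  by move=> [sK _]; split; exact: sK.
apply: graph_eq => [|u v]; first by apply/seteqP; split=> u /B.
have E' : vert (gball G N) v -> edge G u v <-> edge H u v.
  by rewrite (sym G) // (sym H) //; exact: E.
split=> /= -[uv Buv]; (split; last by case: Buv => /B; tauto).
- by case: Buv => /[dup] Bu; [move/E|move/E'] => <-.
- by case: Buv => /B /[dup] Bu; [move/E|move/E'] => ->.
Qed.

Lemma gball_induced (W W' : set Z2) N : W 0 ->
  (forall p, (l1norm p <= N)%N -> W p <-> W' p) ->
  gball (induced W) N = gball (induced W') N.
Proof.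
move=> W0 WW'; apply: gball_local => [||m u w mN mu _];
  [exact: subgraph_induced|exact: subgraph_induced|].
have := walk_l1norm (subgraph_induced W) mu; rewrite subr0 => um.
have Wu := WW' u (leq_trans um (ltnW mN)).
split=> -[uW wW uw]; split => //; try exact/Wu; apply/WW' => //;
  by move/adjacentE: uw um mN; rewrite /l1norm; lia.
Qed.

(** The ball of radius [m + N] about 0 contains the ball of radius [N] about a vertex reached in [m]
    steps. *)
Lemma gball_translate G H v m N : subgraph G -> subgraph H ->
  gball G (m + N) = gball H (m + N) -> walk G m 0 v ->
  gball (translate (- v) G) N = gball (translate (- v) H) N.
Proof.
move=> sG sH GH mv.
apply: gball_local; try by apply: subgraph_gmap => // p q; exact: translate_adjacent.
move=> j u w jN /walk_translate; rewrite add0r => ju _.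
have mju := walk_cat mv ju.
have jmN : (m + j < m + N)%N by rewrite ltn_add2l.
rewrite !translateE /=; split=> uw.
  suff : edge (gball H (m + N)) (u + v) (w + v) by case.
  by rewrite -GH; split => //; left; exists (m + j)%N.
suff : edge (gball G (m + N)) (u + v) (w + v) by case.
rewrite GH; split => //; left; exists (m + j)%N => //.
exact: gball_walk GH (ltnW jmN) mju.
Qed.

(** Membership of [T] in the envelope of [S], freed from the metric and stated for plain graphs. *)
Definition adherent (S T : graph) : Prop := forall N,
  exists2 v, vert S v & gball T N = gball (translate (- v) S) N.

Lemma closure_rel_class (R : realType) (S T : calT R) :
  closure (rel_class S) T <-> adherent S T.
Proof.
split=> [clT N|ST B].
  (* [N.+1] rather than [N], since [agreementP] only speaks of positive radii. *)
  have [|U [[v Sv Uv] TU]] := clT (ball T (sequences.expR (- N.+1%:R))).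
    by apply/nbhs_ballP; exists (sequences.expR (- N.+1%:R)) => //=; exact: expR_gt0.
  exists v => //; rewrite -Uv; apply: (@gball_le _ _ _ N.+1) => //.
  apply: (@agreementP R) => //; rewrite -leeN2 -lee_expeR -tdistE lee_fin.
  exact: ltW.
move=> /nbhs_ballP[e /= e0 TB].
(* Then [1 / e < N <= 1 + N <= exp N], that is, [exp (- N) < e]. *)
pose N := (Num.truncn e^-1).+1.
have [v Sv TSv] := ST N.
pose U : calT R := RSubgraph (translate_rooted (rsubgraphP S) Sv).
exists U; split; first by exists v.
apply: TB; have : tdist T U < e; last by [].
rewrite -lte_fin tdistE; apply: (@le_lt_trans _ _ (expeR (- (N%:R)%:E))).
  by rewrite lee_expeR leeN2; exact: agreement_le.
rewrite /= lte_fin expRN -[e]invrK ltf_pV2 ?posrE ?invr_gt0 ?expR_gt0 //.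
apply: lt_le_trans (truncnS_gt _) _; apply: le_trans (expR_ge1Dx _).
by rewrite lerDr.
Qed.

Lemma rooted_gball_inj (R : realType) G H :
  rooted_subgraph G -> rooted_subgraph H ->
  (forall N, gball G N = gball H N) -> G = H.
Proof.
move=> rG rH GH; pose T : calT R := RSubgraph rG; pose U : calT R := RSubgraph rH.
suff : T = U by move/(congr1 (@Defs.rgraph)).
apply: tdist_positivity; rewrite -(tdistxx T) /tdist /agreement.
congr (fine (expeR (- maxe _ (ereal_sup _)))); apply/seteqP.
by split=> _ [N [N1 _] <-]; exists N => //; split => //; exact: GH.
Qed.

(** The ball of radius [N] about a vertex [v] of [T], at [m] steps from 0, sits in the ball of
    radius [m + N] about 0. A copy of the latter in [S] about [w] contains a copy of the former
    about [v + w]. *)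
Lemma adherent_trans S T U : rooted_subgraph S -> rooted_subgraph T -> rooted_subgraph U ->
  adherent S T -> adherent T U -> adherent S U.
Proof.
move=> [sS _ _ S0] [sT cT _ T0] [sU _ _ U0] ST TU N.
have [v Tv ->] := TU N; have [m mv] := cT _ _ T0 Tv.
have [w Sw TS] := ST (m + N)%N; exists (v + w).
  have := gball_walk TS (leq_addr _ _) mv.
  move=> /walk_translate; rewrite add0r => vw; exact: walk_vert sS Sw vw.
rewrite -translate_translate; apply: gball_translate TS mv => //.
by apply: subgraph_gmap => // p q; exact: translate_adjacent.
Qed.

(** * Coded trees *)

Definition coded_site (alpha : S4) : set Z2 :=
  [set p | exists n, diamond n (p - center alpha n)].

Lemma diamond_center_le alpha m n p : (m <= n)%N ->
  diamond m (p - center alpha m) -> diamond n (p - center alpha n).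
Proof.
move=> /subnK <-; elim: (n - m)%N => [//|k IH] /IH.
by move=> /diamond_center_step[].
Qed.

Lemma diamond0 n : diamond n 0.
Proof. by split; [exact: site0|rewrite expn_gt0]. Qed.

Lemma coded_site0 alpha : coded_site alpha 0.
Proof. by exists 0%N; rewrite subr0; exact: diamond0. Qed.

Lemma coded_graphE alpha : coded_graph alpha = induced (coded_site alpha).
Proof.
apply: graph_eq => [|u v].
  apply/seteqP; split=> p; first by move=> [n _]; rewrite patternE; exists n.
  by move=> [n pn]; exists n => //; rewrite patternE.
split=> [[n]|[[m um] [n vn] uv]].
  by rewrite patternE => -[un vn uv]; split => //; exists n.
exists (maxn m n); rewrite patternE; split => //=.
  exact: diamond_center_le (leq_maxl _ _) um.
exact: diamond_center_le (leq_maxr _ _) vn.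
Qed.

(** The increments from level [m] on are unit vectors times [2 ^ k] with [k >= m]; only the one with
    [k = m] affects the parity of [d]. *)
Lemma center_shift alpha m n : (m < n)%N ->
  exists2 d, odd (l1norm d) & center alpha n = center alpha m + d *+ 2 ^ m.
Proof.
move=> /subnK <-; elim: (n - m.+1)%N => [|k [d od dE]].
  by exists (direction (alpha m)); rewrite ?unit_direction.
exists (d + direction (alpha (k + m.+1)%N) *+ 2 ^ k.+1).
  move: od; rewrite mulrn_expS mulrnZ2 /l1norm /=; lia.
by rewrite addSn [LHS]/= dE mulrnDl addrA -mulrnA -expnD addSnnS.
Qed.

Lemma coded_site_near alpha n p : (l1norm p < 2 ^ n)%N ->
  coded_site alpha (p + center alpha n) <-> site p.
Proof.
move=> pn; split=> [[m pm]|sp]; last by exists n; rewrite addrK.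
(* A level above [n] is needed for the two centres to differ by some [d *+ 2 ^ n] with [d] of odd
   norm. *)
have := diamond_center_le (leq_maxl m n.+1) pm.
have [d od ->] := center_shift alpha (leq_maxr m n.+1 : (n < _)%N).
rewrite opprD addrA addrK -mulNrn => -[+ _].
by move/site_shift_odd; apply => //; rewrite l1normN.
Qed.

Lemma adherent_coded_kenyon alpha :
  adherent (induced (coded_site alpha)) (induced site).
Proof.
move=> N; exists (center alpha N).
  by rewrite /= -[center _ _]add0r; apply/coded_site_near; [rewrite expn_gt0|exact: site0].
rewrite translate_induced; apply: gball_induced; first exact: site0.
move=> p pN; symmetry; apply: coded_site_near.
exact: leq_ltn_trans pN (ltn_expl _ _).
Qed.

(** * Finiteness arguments: one level for a whole ball *)

Lemma uniform_seq (A : eqType) (s : seq A) (Q : nat -> A -> Prop) :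
  (forall m n a, (m <= n)%N -> Q m a -> Q n a) ->
  (forall a, a \in s -> exists n, Q n a) -> exists n, forall a, a \in s -> Q n a.
Proof.
move=> mono; elim: s => [|a s IH] sQ; first by exists 0%N.
have [n nQ] := IH (fun b bs => sQ b (mem_behead (s := a :: s) bs)).
have [m mQ] := sQ a (mem_head _ _).
exists (maxn m n) => b; rewrite inE => /predU1P[->|/nQ].
  exact: mono (leq_maxl _ _) mQ.
exact: mono (leq_maxr _ _).
Qed.

(** Otherwise each [a] fails from some rank on, and by [uniform_seq] all fail at a common rank. *)
Lemma pigeonhole_seq (A : eqType) (s : seq A) (Q : nat -> A -> Prop) :
  (forall m n a, (m <= n)%N -> Q n a -> Q m a) ->
  (forall n, exists2 a, a \in s & Q n a) -> exists2 a, a \in s & forall n, Q n a.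
Proof.
move=> mono sQ; apply: contrapT => noa.
have [||n nQ] := @uniform_seq A s (fun n a => ~ Q n a).
- by move=> m n a mn nQm Qn; apply: nQm; exact: mono Qn.
- move=> a sa; apply: contrapT => aQ; apply: noa; exists a => // n.
  by apply: contrapT => nQ; apply: aQ; exists n.
by have [a /nQ] := sQ n.
Qed.

Lemma l1norm_ball_finite M : exists s : seq Z2, forall p, (l1norm p <= M)%N -> p \in s.
Proof.
pose I : seq int := [seq (i%:Z - M%:Z) | i <- iota 0 (2 * M).+1].
have memI (a : int) : (`|a| <= M)%N -> a \in I.
  move=> aM; apply/mapP; exists (absz (a + M%:Z)); last by lia.
  by rewrite mem_iota; lia.
exists [seq (a, b) : Z2 | a <- I, b <- I] => -[a b]; rewrite /l1norm /= => pM.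
have [am bm] : (`|a| <= M)%N /\ (`|b| <= M)%N by lia.
exact (allpairs_f (R := Z2) (fun a b => (a, b) : Z2) (memI a am) (memI b bm)).
Qed.

Lemma coded_site_ball alpha M : exists n, forall p, (l1norm p <= M)%N ->
  coded_site alpha p -> diamond n (p - center alpha n).
Proof.
have [s sM] := l1norm_ball_finite M.
have [||n nQ] := @uniform_seq _ s (fun n p => coded_site alpha p ->
  diamond n (p - center alpha n)).
- by move=> m n p mn h /h; exact: diamond_center_le.
- move=> p _; case: (pselect (coded_site alpha p)) => [[n pn]|np]; first by exists n.
  by exists 0%N.
by exists n => p /sM /nQ.
Qed.

(* The sites of a shifted tree on the boundary of a copy of a diamond are the
   centers of higher level which this copy is attached to. *)
Lemma site_boundary n (p d : Z2) : odd (l1norm d) -> l1norm p = (2 ^ n)%N ->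
  site (p + d *+ 2 ^ n) -> exists q, p + d *+ 2 ^ n = q *+ 2 ^ n.+1.
Proof.
move=> od; elim: n p => [|n IH] p pn.
  by apply: site_even; move: od pn; rewrite mulr1n /l1norm expn0 /=; lia.
rewrite mulrn_expS => sp.
have [q pq] : exists q, p + d *+ 2 ^ n *+ 2 = q *+ 2.
  apply: site_even sp; move: pn; rewrite expnS.
  by rewrite mulrnZ2 /l1norm /=; lia.
have pE : p = (q - d *+ 2 ^ n) *+ 2 by rewrite mulrnBl -pq addrK.
have [||r qr] := IH (q - d *+ 2 ^ n).
- by move: pn; rewrite {1}pE l1norm_double expnS; lia.
- by rewrite subrK; apply/site_double; rewrite -pq.
by exists r; rewrite pq mulrn_expS -qr subrK.
Qed.

(** The shift by [v] carries the diamond about [center alpha n] to sites about [d *+ 2 ^ n]. By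
    [site_boundary], a walk on sites leaves that diamond only through a multiple of [2 ^ n.+1],
    which the last hypothesis forbids; the previous one confines the ball of the coded tree to the
    diamond. *)
Lemma gball_coded alpha n M v d : odd (l1norm d) ->
  center alpha n + v = d *+ 2 ^ n ->
  (forall p, (l1norm p <= M)%N -> coded_site alpha p ->
     diamond n (p - center alpha n)) ->
  (forall m w, (m <= M)%N -> walk (induced [set p | site (p + v)]) m 0 w ->
     ~ exists q, w + v = q *+ 2 ^ n.+1) ->
  gball (induced (coded_site alpha)) M = gball (induced [set p | site (p + v)]) M.
Proof.
move=> od cv near far.
have shift p : p + v = p - center alpha n + d *+ 2 ^ n by rewrite -cv addrA subrK.
have near_site p : diamond n (p - center alpha n) -> site (p + v).
  by move=> [sp pn]; rewrite shift; apply/site_shift_odd.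
apply: gball_local => [||m u w mM mu mu']; [exact: subgraph_induced|exact: subgraph_induced|].
have := walk_l1norm (subgraph_induced _) mu; rewrite subr0 => um.
split=> -[uW wW uw].
  have wm : (l1norm w <= M)%N.
    by move/adjacentE: uw um mM; rewrite /l1norm; lia.
  split => //=; apply: near_site; apply: near => //.
  exact: leq_trans um (ltnW mM).
have cu : coded_site alpha u.
  exact: walk_vert (subgraph_induced _) (coded_site0 alpha) mu.
split => //; exists n; have [_ un] := near _ (leq_trans um (ltnW mM)) cu.
have wn : (l1norm (w - center alpha n) <= 2 ^ n)%N.
  by move/adjacentE: uw un; rewrite /l1norm /=; lia.
case: (ltngtP (l1norm (w - center alpha n)) (2 ^ n)) wn => // wn _.
  by split => //; move: wW; rewrite /= shift => /site_shift_odd; apply.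
have [q wq] : exists q, w + v = q *+ 2 ^ n.+1.
  by rewrite shift; apply: site_boundary od wn _; rewrite -shift.
by case: (far m.+1 w) => //; [exact: walk_rcons mu' _|exists q].
Qed.

Lemma adherent_kenyon_coded alpha :
  adherent (induced site) (induced (coded_site alpha)).
Proof.
move=> M; have [n0 nearM] := coded_site_ball alpha M.
pose n := maxn n0 M; set x := center alpha n.
have Mn : (M < 2 ^ n)%N by exact: leq_ltn_trans (leq_maxr _ _) (ltn_expl _ _).
have x0 : diamond n (0 - x).
  by apply: (diamond_center_le (leq0n n)); rewrite subr0; exact: diamond0.
(* The Kenyon tree is viewed from [d *+ 2 ^ n - x], where [d] has to keep the multiples of
   [2 ^ n.+1] out of the ball. *)
suff [d [od far]] : exists d : Z2, odd (l1norm d) /\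
    forall w, (l1norm w <= M)%N -> ~ exists q, w - x + d *+ 2 ^ n = q *+ 2 ^ n.+1.
  exists (d *+ 2 ^ n - x).
    rewrite /= addrC; apply/site_shift_odd => //.
      by case: x0 => _; rewrite sub0r.
    by case: x0 => + _; rewrite sub0r.
  rewrite translate_induced; apply: (@gball_coded _ n _ _ d) => //.
  - by rewrite addrCA subrr addr0.
  - by move=> p pM cp; apply: diamond_center_le (nearM _ pM cp); exact: leq_maxl.
  move=> m w mM /(walk_l1norm (subgraph_induced _)); rewrite subr0 => wm.
  by rewrite [_ - x]addrC addrA; apply: far; exact: leq_trans mM.
apply: contrapT => none.
have E (d : Z2) : odd (l1norm d) ->
    exists w q, (l1norm w <= M)%N /\ w - x + d *+ 2 ^ n = q *+ 2 ^ n.+1.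
  move=> od; apply: contrapT => nw; apply: none; exists d; split => // w wM [q wq].
  by apply: nw; exists w, q.
(* If [(1, 0)] and [(0, 1)] both fail, the two obstructing points differ by odd multiples of [2 ^ n]
   in both coordinates, hence by at least [2 ^ n.+1] in norm, too much for points of norm at most
   [M < 2 ^ n]. *)
have [w [q [wM wq]]] := E (1, 0) isT; have [w' [q' [wM' wq']]] := E (0, 1) isT.
have : w - w' = (q - q') *+ 2 ^ n.+1 - (1, -1) *+ 2 ^ n.
  rewrite mulrnBl -wq -wq'.
  by rewrite !mulrnZ2; apply: pairE => /=; lia.
have -> : (q - q') *+ 2 ^ n.+1 - (1, -1) *+ 2 ^ n = ((q - q') *+ 2 - (1, -1)) *+ 2 ^ n.
  by rewrite [RHS]mulrnBl mulrn_expS mulrnAC.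
move: (q - q') => r; rewrite mulrnZ2 [r *+ 2]mulrnZ2 => ww'.
have h1 : (2 ^ n <= absz (w.1 - w'.1))%N.
  by have := congr1 fst ww'; rewrite /= => ->; rewrite abszM leq_pmull //; lia.
have h2 : (2 ^ n <= absz (w.2 - w'.2))%N.
  by have := congr1 snd ww'; rewrite /= => ->; rewrite abszM leq_pmull //; lia.
by move: h1 h2 wM wM' Mn; rewrite /l1norm; lia.
Qed.

(** * Limits of the Kenyon tree *)

Lemma rooted_site : rooted_subgraph (induced site).
Proof. by rewrite -kenyon_limitE; exact: kenyon_limit_rooted. Qed.

Lemma rooted_coded_site alpha : rooted_subgraph (induced (coded_site alpha)).
Proof. by rewrite -coded_graphE; exact: coded_graph_rooted. Qed.

(** Write [d = p *+ 2 + s] with [s] a unit vector: adding [- s] or [s] gives twice [p] or twice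
    [p + s], one of which has odd norm. So a centre of level [n] is at [2 ^ n] from one of level
    [n.+1]. *)
Lemma parent_direction (d : Z2) : odd (l1norm d) ->
  exists (k : 'I_4) (d' : Z2), odd (l1norm d') /\ d + direction k = d' *+ 2.
Proof.
move=> od.
have [s [s1 [d' [od' dE]]]] : exists s : Z2, l1norm s = 1%N /\
    exists d' : Z2, odd (l1norm d') /\ d + s = d' *+ 2.
  have H (s p : Z2) : l1norm s = 1%N -> d = p *+ 2 + s -> exists s : Z2,
      l1norm s = 1%N /\ exists d' : Z2, odd (l1norm d') /\ d + s = d' *+ 2.
    move=> s1 ->; case: (boolP (odd (l1norm p))) => op.
      by exists (- s); rewrite l1normN addrK; split => //; exists p.
    exists s; split => //; exists (p + s); split; last by rewrite mulrnDl addrA.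
    by move: op; case/unit_cases: s1 => ->; rewrite /l1norm /=; lia.
  move: od; rewrite /l1norm => od.
  have [s s1 [p dE]] : exists2 s : Z2, l1norm s = 1%N & exists p, d - s = p *+ 2.
    by case: (boolP (odd `|d.1|)) => o1; [exists (1, 0)|exists (0, 1)] => //;
      apply: halve => /=; lia.
  by apply: (H s p s1); rewrite -dE subrK.
have [k ks] := @turn_unit (1, 0) s erefl s1.
by exists k, d'; split => //; rewrite -dE -ks.
Qed.

(** Among points of norm less than [2 ^ n], the sites look the same from a site divisible by [2 ^ n]
    as from the origin. *)
Lemma limit_kenyon (R : realType) T (v : nat -> Z2) w : rooted_subgraph T ->
  (forall N, site (v N)) ->
  (forall N, gball T N = gball (induced [set p | site (p + v N)]) N) ->
  vert T w -> (forall n, exists N q, (n <= N)%N /\ w + v N = q *+ 2 ^ n) ->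
  translate (- w) T = induced site.
Proof.
move=> rT sv Tv Tw inf.
apply: (rooted_gball_inj R); [exact: translate_rooted|exact: rooted_site|move=> M].
case: (rT) => sT cT _ T0; have [m mw] := cT _ _ T0 Tw.
(* [m] steps to reach [w], and [M] more to see the ball around it. *)
have [N [q [nN wq]]] := inf (m + M)%N.
have TN : gball T (m + M) = gball (induced [set p | site (p + v N)]) (m + M).
  exact: gball_le (Tv N).
rewrite (gball_translate sT (subgraph_induced _) TN mw) translate_induced.
have sw : site (w + v N).
  have /walk_vert := gball_walk TN (leq_addr _ _) mw.
  by move=> /(_ (subgraph_induced _)); apply; rewrite /= add0r.
apply: gball_induced; first by rewrite /= add0r.
move=> p pM; rewrite /= -addrA wq; case: (pselect (p = 0)) => [->|p0].
  by rewrite add0r -wq; split=> _ //; exact: site0.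
apply: site_shift => //; apply: leq_ltn_trans pM _.
exact: leq_ltn_trans (leq_addl _ _) (ltn_expl _ _).
Qed.

Lemma exists_coding (v : nat -> Z2) :
  (forall k, exists2 N, (k <= N)%N & odd (l1norm (v N))) ->
  exists alpha, forall n k, exists N d, [/\ (k <= N)%N, odd (l1norm d) &
    center alpha n + v N = d *+ 2 ^ n].
Proof.
(* Invariant for choosing the digits one by one: for arbitrarily large [N], the shift by [v N] sends
   [x] to a centre of level exactly [n]. *)
move=> ov; pose good n x := forall k, exists N (d : Z2),
  [/\ (k <= N)%N, odd (l1norm d) & x + v N = d *+ 2 ^ n].
have step n x : exists j : 'I_4, good n x -> good n.+1 (x + direction j *+ 2 ^ n).
  case: (pselect (good n x)) => [gx|]; last by exists ord0.
  (* Each suitable [N] provides a direction; one of the four recurs for arbitrarily large [N]. *)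
  have [||j _ gj] := @pigeonhole_seq _ (enum 'I_4) (fun k j => exists N (d : Z2),
    [/\ (k <= N)%N, odd (l1norm d) & x + direction j *+ 2 ^ n + v N = d *+ 2 ^ n.+1]).
  - by move=> k k' j kk' [N [d [kN od dE]]]; exists N, d; split => //; exact: leq_trans kN.
  - move=> k; have [N [d [kN od dE]]] := gx k.
    have [j [d' [od' d'E]]] := parent_direction od.
    exists j; rewrite ?mem_enum //; exists N, d'; split => //.
    by rewrite addrAC dE -mulrnDl d'E mulrn_expS mulrnAC.
  by exists j.
pose f n x := projT1 (cid (step n x)).
pose x := fix x n := if n is m.+1 then x m + direction (f m (x m)) *+ 2 ^ m else 0.
pose alpha n := f n (x n); exists alpha.
have xE n : center alpha n = x n by elim: n => //= n ->.
elim=> [|n IH].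
  by move=> k; have [N kN oN] := ov k; exists N, (v N); rewrite /= add0r.
by rewrite /= xE; apply: (projT2 (cid (step n (x n)))); rewrite -xE.
Qed.

(** If the balls of radius [M] differed, [gball_coded] would be inapplicable at every level: for
    each [n], some vertex [w] of norm at most [M] would have [w + v N] divisible by [2 ^ n] for a
    late [N]. By finiteness one [w] would serve for all [n], which is excluded. *)
Lemma limit_coded (R : realType) T (v : nat -> Z2) : rooted_subgraph T ->
  (forall N, gball T N = gball (induced [set p | site (p + v N)]) N) ->
  (forall k, exists2 N, (k <= N)%N & odd (l1norm (v N))) ->
  ~ (exists2 w, vert T w & forall n, exists N q, (n <= N)%N /\ w + v N = q *+ 2 ^ n) ->
  exists alpha, T = induced (coded_site alpha).
Proof.
move=> rT Tv ov noinf; have [alpha good] := exists_coding ov; exists alpha.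
apply: (rooted_gball_inj R) => // [|M]; first exact: rooted_coded_site.
apply: contrapT => ne; apply: noinf.
have [n0 near] := coded_site_ball alpha M; have [s sM] := l1norm_ball_finite M.
have [||w _ wP] := @pigeonhole_seq _ s (fun n w => vert T w /\
    exists N q, (n <= N)%N /\ w + v N = q *+ 2 ^ n).
- move=> m n w mn [Tw [N [q [nN wq]]]]; split => //.
  exists N, (q *+ 2 ^ (n - m)); split; first exact: leq_trans nN.
  by rewrite -mulrnA -expnD subnK.
- move=> n; apply: contrapT => no; apply: ne.
  (* At least [n0] for the diamond to cover the ball, at least [n] for the divisibility. *)
  pose m := maxn n n0.
  have [N [d [kN od dE]]] := good m (maxn n M).+1.
  have MN : (M <= N)%N by apply: leq_trans (leq_maxr n M) (ltnW kN).
  rewrite (gball_le MN (Tv N)); symmetry.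
  apply: (gball_coded od dE) => [p pM cp|j w jM jw [q wq]].
    by apply: diamond_center_le (near _ pM cp); exact: leq_maxr.
  have Tjw := gball_walk (esym (Tv N)) (leq_trans jM MN) jw.
  apply: no; exists w.
    apply: sM; have := walk_l1norm (subgraph_induced _) jw; rewrite subr0.
    by move/leq_trans; apply.
  case: rT => sT _ _ T0; split; first exact: walk_vert sT T0 Tjw.
  exists N, (q *+ 2 ^ (m.+1 - n)); split.
    exact: leq_trans (leq_maxl n M) (ltnW kN).
  rewrite -mulrnA -expnD subnK //.
  exact: leq_trans (leq_maxl n n0) (leqnSn _).
by exists w => [|n]; case: (wP 0%N) => //; case: (wP n).
Qed.

Lemma rooted_neighbor T : rooted_subgraph T -> exists w, edge T 0 w.
Proof.
move=> [sT cT iT T0].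
have [u Tu u0] : exists2 u, vert T u & u <> 0.
  apply: contrapT => no; apply: iT; apply: sub_finite_set (finite_set1 (0 : Z2)).
  by move=> u Tu; apply: contrapT => u0; apply: no; exists u.
by have [[|n] /= h] := cT _ _ T0 Tu; [case: u0|case: h => w; exists w].
Qed.

Lemma adherent_kenyonP (R : realType) T : rooted_subgraph T -> adherent (induced site) T ->
  (exists2 w, vert T w & translate (- w) T = induced site) \/
  (exists2 w, vert T w & exists alpha, translate (- w) T = induced (coded_site alpha)).
Proof.
move=> rT ad.
have [v vP] : exists v : nat -> Z2, forall N, site (v N) /\
    gball T N = gball (induced [set p | site (p + v N)]) N.
  have ad' N : exists w, site w /\ gball T N = gball (induced [set p | site (p + w)]) N.
    by have [w sw] := ad N; rewrite translate_induced; exists w.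
  by have [v vP] := choice ad'; exists v.
have sv N := (vP N).1; have Tv N := (vP N).2.
case: (pselect (exists2 w, vert T w &
    forall n, exists N q, (n <= N)%N /\ w + v N = q *+ 2 ^ n)) => [[w Tw inf]|noinf].
  by left; exists w => //; exact: (limit_kenyon R rT sv Tv Tw inf).
right; case: (rT) => sT _ _ T0.
case: (pselect (forall k, exists2 N, (k <= N)%N & odd (l1norm (v N)))) => [ov|nov].
  have [alpha ->] := limit_coded R rT Tv ov noinf.
  by exists 0; [exact: coded_site0|exists alpha; rewrite translate0].
(* Here [v N] has even norm from some rank on; moving the root to a neighbour [w] of 0 makes it odd.
   The index [N.+1] below pays for this step. *)
have [w Tw] := rooted_neighbor rT.
have [aw _ vw] : [/\ adjacent 0 w, vert T 0 & vert T w] by case: sT => _; apply.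
exists w => //; apply: (limit_coded R (v := fun N => w + v N.+1)).
- exact: translate_rooted.
- move=> N; have w1 : walk T 1 0 w by exists w.
  rewrite (gball_translate sT (subgraph_induced _) (Tv (1 + N)%N) w1) translate_induced.
  by congr (gball (induced _) _); apply/seteqP; split=> p /=; rewrite addrA.
- have [k0 ev] : exists k, forall N, (k <= N)%N -> ~~ odd (l1norm (v N)).
    apply: contrapT => no; apply: nov => k; apply: contrapT => nk; apply: no; exists k => N kN.
    by apply/negP => oN; apply: nk; exists N.
  move=> k; exists (maxn k k0); first exact: leq_maxl.
  have := ev (maxn k k0).+1 (leq_trans (leq_maxr _ _) (leqnSn _)).
  by move/adjacent0: aw; rewrite /l1norm /=; lia.
move=> [u Tu inf]; apply: noinf; exists (u + w); first by rewrite translateE in Tu.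
move=> n; have [N [q [nN uq]]] := inf n; exists N.+1, q; rewrite -addrA.
by split => //; exact: leqW.
Qed.

(** Relative to a later centre, [c] is a nonzero [d *+ 2 ^ j] with [d] of odd norm. Were [c] to play
    the role of 0, each [c + s *+ 2 ^ j] with [s] a unit vector would be a vertex; the [s] making
    both coordinates of [d + s] odd contradicts this. *)
Lemma coded_neq_kenyon alpha c : coded_site alpha c ->
  translate (- c) (induced (coded_site alpha)) <> induced site.
Proof.
move=> [m cm] E.
have EW p : coded_site alpha (p + c) <-> site p.
  have := congr1 (fun G => vert G p) E; rewrite translate_induced /= => ->; tauto.
have [[sc cn] cx] := diamond_center_step cm.
have [c0|[j [d [od cE]]]] := sc.
  by case: cx; rewrite -[c](subrK (center alpha m.+1)) c0 add0r.
have jm : (j <= m)%N.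
  move: cn; rewrite cE mulrnZ2 /l1norm /= !abszM /= -mulnDl expnS => h.
  rewrite leqNgt; apply/negP => mj.
  have := leq_pexp2l (isT : 0 < 2)%N mj; rewrite expnS; move: od h; rewrite /l1norm.
  by case: (_ + _)%N => // a _ h h'; move: h; rewrite ltnNge mulSn; case/negP; lia.
have [s s1 [os1 os2]] : exists2 s : Z2, l1norm s = 1%N &
    odd `|(d + s).1| /\ odd `|(d + s).2|.
  move: od; rewrite /l1norm => od; case: (boolP (odd `|d.1|)) => o1.
    by exists (0, 1) => //=; lia.
  by exists (1, 0) => //=; lia.
have [n cn'] : coded_site alpha (s *+ 2 ^ j + c).
  by apply/EW; apply/site_mul; apply: site_odd; rewrite s1.
have {}cn' := diamond_center_le (leq_maxl n m.+2) cn'.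
have [e oe eE] := center_shift alpha (leq_maxr n m.+2 : (m.+1 < _)%N).
(* As [j <= m], later centres differ from [center alpha m.+1] by multiples of [2 ^ j.+1], so the
   coordinates divided by [2 ^ j] stay odd. *)
case: cn' => + _; rewrite eE opprD addrA -[s *+ _ + c - _]addrA cE.
have -> : e *+ 2 ^ m.+1 = e *+ 2 ^ (m - j).+1 *+ 2 ^ j.
  by rewrite -mulrnA -expnD addSn subnK.
rewrite -mulrnDl -mulrnBl => /site_mul; apply: site_both_odd;
  by move: os1 os2; rewrite mulrn_expS mulrnZ2 /=; lia.
Qed.

Theorem proposition3p1 (R : realType) :
  (forall alpha : S4, ghys_kenyon R = closure (rel_class (Phi R alpha))) /\
  ghys_kenyon R =
    rel_class (kenyon_tree R) `|`
    \bigcup_(alpha in [set: S4]) rel_class (Phi R alpha) /\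
  rel_class (kenyon_tree R) `&`
    \bigcup_(alpha in [set: S4]) rel_class (Phi R alpha) = set0.
Proof.
have KE : Defs.rgraph (kenyon_tree R) = induced site by exact: kenyon_limitE.
have PE alpha : Defs.rgraph (Phi R alpha) = induced (coded_site alpha) by exact: coded_graphE.
have clK (T : calT R) : ghys_kenyon R T <-> adherent (induced site) T.
  by rewrite -KE; exact: closure_rel_class.
have clP alpha (T : calT R) : closure (rel_class (Phi R alpha)) T <->
    adherent (induced (coded_site alpha)) T.
  by rewrite -PE; exact: closure_rel_class.
have memcl (S T : calT R) : rel_class S T -> adherent S T.
  by move=> [v Sv ->] N; exists v.
have move_back (S T : graph) v w : translate (- v) S = translate (- w) T ->
    translate (- (w - v)) T = S.
  by move=> E; rewrite addrC -translate_translate -E translate_translate addNr translate0.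
(* By transitivity, it suffices that each of the two trees is adherent to the other. *)
have env alpha : ghys_kenyon R = closure (rel_class (Phi R alpha)).
  apply/seteqP; split=> T.
    move=> /clK KT; apply/clP; apply: adherent_trans KT;
      [exact: rooted_coded_site|exact: rooted_site|exact: rsubgraphP|].
    exact: adherent_coded_kenyon.
  move=> /clP PT; apply/clK; apply: adherent_trans PT;
    [exact: rooted_site|exact: rooted_coded_site|exact: rsubgraphP|].
  exact: adherent_kenyon_coded.
have back (S T : calT R) w : vert T w -> translate (- w) T = S -> rel_class S T.
  move=> Tw TS; have E : translate (- - w) S = T.
    by rewrite -TS translate_translate addNr translate0.
  exists (- w) => //; rewrite -TS translateE /= addNr.
  by case: (rsubgraphP T).
split => //; split; apply/seteqP; split=> T //.
- move=> /clK /(adherent_kenyonP R (rsubgraphP T))[[w Tw TK]|[w Tw [alpha TP]]].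
    by left; apply: (back _ _ w) => //; rewrite KE.
  by right; exists alpha => //; apply: (back _ _ w) => //; rewrite PE.
- case=> [KT|[alpha _ PT]]; first by apply/clK; rewrite -KE; exact: memcl.
  by rewrite (env alpha); apply/clP; rewrite -PE; exact: memcl.
(* A common element is a translate of both trees, so the Kenyon tree would be a translate of the
   coded one. *)
case=> [[v Kv TK] [alpha _ [w Pw TP]]].
have E : translate (- (w - v)) (induced (coded_site alpha)) = induced site.
  by apply: move_back; rewrite -PE -KE -TK -TP.
apply: (@coded_neq_kenyon alpha (w - v) _ E).
by have := site0; rewrite -[site]/(vert (induced site)) -E translate_induced /= add0r.
Qed.
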